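(* Let $q=p^e$ be a power of a prime $p$, let $d\geq 2$ be an even integer with $q\equiv 1 \pmod{2d(d-1)}$, and let $a,b\in\mathbb{F}_q^\times$. Let $N'_d=\#\{(x,y)\in\mathbb{F}_q^2 : y^2=x^d+ax^{d-1}+b\}$. Let $T$ be a generator of $\widehat{\mathbb{F}_q^\times}$ and put $\chi=T^{\frac{q-1}{d}}$ (order $d$) and $\psi=T^{\frac{q-1}{2(d-1)}}$ (order $2(d-1)$). Then $$N'_d=q+\phi(b)+q^{\frac d2}\,\phi(d-1)\;{}_{d}F_{d-1}\!\left(\begin{array}{c}A_0,A_1,\ldots,A_{d-1}\\ B_1,\ldots,B_{d-1}\end{array}\Big|\ \beta\right),$$ where $\beta=\dfrac{bd^d}{a^d(d-1)^{d-1}}$, $A_0=\phi$, $A_1=\varepsilon$, $B_1=\phi$, and the remaining $d-2$ pairs $(A_i,B_i)$, $i=2,\ldots,d-1$, are the pairs $(\chi^j,\psi^{2j-1})$ for $j\in\{1,\ldots,d-1\}\setminus\{d/2\}$ in increasing order of $j$; i.e. the top row is $\phi,\varepsilon,\chi,\chi^2,\ldots,\chi^{\frac{d-2}{2}},\chi^{\frac{d+2}{2}},\ldots,\chi^{d-1}$ and the bottom row is $\phi,\psi,\psi^3,\ldots,\psi^{d-3},\psi^{d+1},\ldots,\psi^{2d-3}$.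
   Context: $\widehat{\mathbb{F}_q^\times}$ denotes the group of multiplicative characters of $\mathbb{F}_q^\times$; every character (including the trivial one) is extended to $\mathbb{F}_q$ by setting $\chi(0)=0$. $\varepsilon$ is the trivial character and $\phi$ the quadratic character. For characters $A,B$, $\overline{B}$ is the inverse of $B$ and $${A\choose B}:=\frac{B(-1)}{q}\sum_{x\in\mathbb{F}_q}A(x)\overline{B}(1-x).$$ For characters $A_0,\ldots,A_n,B_1,\ldots,B_n$ and $x\in\mathbb{F}_q$, the Gaussian hypergeometric series is $${}_{n+1}F_n\!\left(\begin{array}{c}A_0,A_1,\ldots,A_n\\ B_1,\ldots,B_n\end{array}\Big|\ x\right):=\frac{q}{q-1}\sum_{\chi}{A_0\chi\choose\chi}{A_1\chi\choose B_1\chi}\cdots{A_n\chi\choose B_n\chi}\chi(x),$$ the sum over all multiplicative characters $\chi$ of $\mathbb{F}_q$. *)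

(* Defs.v *)
From HB Require Import structures.
From mathcomp Require Import all_boot all_order all_algebra all_fingroup all_solvable all_field all_character.
Set Implicit Arguments. Unset Strict Implicit. Unset Printing Implicit Defensive.
Import GRing.Theory Num.Theory.
Local Open Scope ring_scope.

Definition UG (F : finFieldType) := [set: {unit F}]%G.

Definition mch (F : finFieldType) (xi : 'CF(UG F)) : F -> algC :=
  fun x => match insub x with Some u => xi u | None => 0 end.

Definition epsc (F : finFieldType) : F -> algC :=
  fun x => if x == 0 then 0 else 1.

Definition phiq (F : finFieldType) : F -> algC :=
  fun x => if x == 0 then 0 else if [exists y : F, y ^+ 2 == x] then 1 else -1.

(* (A choose B) = B(-1)/q * sum_x A(x) Bbar(1-x);  Bbar(x) = B(x)^-1 (0^-1 = 0 in algC) *)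
Definition jbin (F : finFieldType) (A B : F -> algC) : algC :=
  B (-1) / (#|F|%:R) * \sum_(x : F) A x * (B (1 - x))^-1.

Definition cmul (F : finFieldType) (A B : F -> algC) : F -> algC := fun x => A x * B x.

(* Gaussian hypergeometric series  _{n+1}F_n(A0, A1..An; B1..Bn | x);
   ABs = [:: (A1,B1); ...; (An,Bn)]; the sum runs over all multiplicative
   characters of F_q^x, i.e. the irreducible (= linear) characters of UG F. *)
Definition HGF (F : finFieldType) (A0 : F -> algC) (ABs : seq ((F -> algC) * (F -> algC))) (x : F) : algC :=
  (#|F|%:R) / ((#|F|)%:R - 1) *
  \sum_(i : Iirr (UG F))
     (jbin (cmul A0 (mch 'chi_i)) (mch 'chi_i) *
      \prod_(AB <- ABs) jbin (cmul AB.1 (mch 'chi_i)) (cmul AB.2 (mch 'chi_i)) *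
      mch 'chi_i x).

(* Main.v *)
(* Both sides, as functions of b, are expanded in multiplicative characters eta.  On the side of
   the curve, the eta-coefficient is a product of two Jacobi sums in eta and rho = phi / eta; on the
   hypergeometric side it is a product of Gauss sums of eta times the powers of chi, and of 1 / eta
   times the odd powers of 1 / psi.  The Hasse-Davenport product formula
     prod_(j < m) g(chi^j eta) = eta(m)^(-m) g(eta^m) prod_(1 <= j < m) g(chi^j),
   with m = d and with m = d - 1, collapses the latter to the former; the characters for which a
   Jacobi sum degenerates are checked separately.

   The product formula is proved by comparing L-functions.  For monic f over F_q with roots r_i,
   let Lambda_m(f) = eta(prod r_i^m) theta(sum r_i^m).  The pullback under x |-> x^m gives
     sum_f Lambda_m(f) u^(deg f) = prod_(j < m) (1 + g(chi^j eta) u),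
   which is read off the logarithmic derivatives, i.e. sums over the fields F_(q^k).  The
   coefficient of u^m on the left factors, since by Newton's identities the m-th power sum of the
   roots of f + c is that of f minus m c: it is eta(m)^(-m) g(eta^m) times a constant that does
   not depend on eta. *)
Require Import Defs.
From HB Require Import structures.
From mathcomp Require Import all_boot all_order all_algebra all_fingroup all_solvable all_field all_character.
From mathcomp Require Import ring zify.
Set Implicit Arguments. Unset Strict Implicit. Unset Printing Implicit Defensive.
Import GRing.Theory Num.Theory.
Local Open Scope ring_scope.

(** * Newton's identities *)

Section Newton.
Variable R : comNzRingType.
Implicit Type s : seq R.

(** The coefficients are the signed elementary symmetric functions [(-1)^i e_i] of [s]. Indexing
    from the constant term keeps Newton's identities free of the length of [s]. *)
Definition rev_prod s : {poly R} := \prod_(x <- s) (1 - x%:P * 'X).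
Definition power_sum s k : R := \sum_(x <- s) x ^+ k.

Lemma coef_rev_prod_cons x s i :
  (rev_prod (x :: s))`_i = (rev_prod s)`_i - x * (if i is j.+1 then (rev_prod s)`_j else 0).
Proof.
rewrite /rev_prod big_cons mulrBl mul1r coefB -mulrA coefCM coefXM.
by case: i.
Qed.

Lemma coef0_rev_prod s : (rev_prod s)`_0 = 1.
Proof.
elim: s => [|x s IHs]; first by rewrite /rev_prod big_nil coef1.
by rewrite coef_rev_prod_cons IHs mulr0 subr0.
Qed.

(** Induction on [s]: the identity for [x :: s] at [i.+1] is the one for [s] at [i.+1] minus [x]
    times the one for [s] at [i], because the terms carrying powers of [x] telescope. *)
Lemma newton_identity s i :
  \sum_(j < i) (rev_prod s)`_j * power_sum s (i - j) + i%:R * (rev_prod s)`_i = 0.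
Proof.
elim: s i => [|x s IHs] i.
  rewrite big1 => [|j _]; last by rewrite /power_sum big_nil mulr0.
  by rewrite /rev_prod big_nil coef1 add0r; case: i => [|i]; rewrite ?mul0r ?mulr0.
case: i => [|i]; first by rewrite big_ord0 mul0r addr0.
have psC k : power_sum (x :: s) k = x ^+ k + power_sum s k by rewrite /power_sum big_cons.
under eq_bigr => j _ do rewrite psC coef_rev_prod_cons mulrDr.
rewrite big_split /= coef_rev_prod_cons.
set b := fun j => (rev_prod s)`_j.
have telescope n :
    \sum_(j < n.+1) (b j - x * (if j : nat is j'.+1 then b j' else 0)) * x ^+ (n.+1 - j) = x * b n.
  elim: n => [|n IHn]; first by rewrite big_ord1 mulr0 subr0 expr1 mulrC.
  rewrite big_ord_recr /= subSnn expr1.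
  under eq_bigr => j _ do rewrite subSn ?(ltnW (ltn_ord j)) // exprS mulrCA.
  by rewrite -mulr_sumr IHn; ring.
rewrite telescope.
have -> : \sum_(j < i.+1) (b j - x * (if j : nat is j'.+1 then b j' else 0)) * power_sum s (i.+1 - j)
   = \sum_(j < i.+1) b j * power_sum s (i.+1 - j) - x * \sum_(j < i) b j * power_sum s (i - j).
  under eq_bigr => j _ do rewrite mulrBl.
  rewrite sumrB; congr (_ - _).
  rewrite big_ord_recl mulr0 mul0r add0r mulr_sumr.
  by apply: eq_bigr => j _; rewrite lift0 subSS mulrA.
transitivity (\sum_(j < i.+1) b j * power_sum s (i.+1 - j) + i.+1%:R * b i.+1
  - x * (\sum_(j < i) b j * power_sum s (i - j) + i%:R * b i)).
  rewrite -natr1 -/(b i) -/(b i.+1); move: (b i) (b i.+1) => bi bi1.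
  by move: (bigop _ _ _) (bigop _ (index_enum 'I_i) _) => S1 S2; ring.
by rewrite !IHs mulr0 subr0.
Qed.

Lemma coef_prod_XsubC_rev s j : (j <= size s)%N ->
  (\prod_(x <- s) ('X - x%:P))`_(size s - j) = (rev_prod s)`_j.
Proof.
elim: s j => [|x s IHs] j /=; first by case: j => // _; rewrite big_nil coef1 coef0_rev_prod.
move=> jle; rewrite big_cons mulrBl coefB coefXM coefCM coef_rev_prod_cons.
have [->|jn] := eqVneq j (size s).+1.
  rewrite subnn /= sub0r -[0%N](subnn (size s)) IHs // -/(rev_prod s).
  suff -> : (rev_prod s)`_(size s).+1 = 0 by rewrite sub0r.
  rewrite nth_default // /rev_prod; elim: (s) => [|y t IHt] /=; first by rewrite big_nil size_poly1.
  rewrite big_cons (leq_trans (size_polyMleq _ _)) //.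
  have : (size (1 - y%:P * 'X)%R <= 2)%N.
    rewrite (leq_trans (size_polyD _ _)) // size_poly1 size_polyN geq_max /=.
    by rewrite (leq_trans (size_polyMleq _ _)) // size_polyX addn2 /= ltnS size_polyC_leq1.
  by move=> sz; rewrite -subn1 leq_subLR (leq_trans (leq_add sz IHt)).
have {jn}jle: (j <= size s)%N by lia.
have -> : ((size s).+1 - j == 0)%N = false by lia.
have -> : ((size s).+1 - j).-1 = (size s - j)%N by lia.
rewrite IHs //; case: j jle => [|j] jle.
  by rewrite subn0 [_`_(size s).+1]nth_default // (size_prod_XsubC s id).
by rewrite subSS IHs // ltnW.
Qed.

End Newton.

(** * Splitting fields of finite fields *)

(** Encoding a monic polynomial of degree [n] by its lower coefficients makes sums over all of them
    sums over a finite type. *)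
Definition monic_rV (F : nzRingType) n (v : 'rV[F]_n) : {poly F} := 'X^n + rVpoly v.

Lemma size_monic_rV (F : nzRingType) n (v : 'rV[F]_n) : size (monic_rV v) = n.+1.
Proof. by rewrite size_polyDl size_polyXn // ltnS size_poly. Qed.

Lemma monic_rV_monic (F : nzRingType) n (v : 'rV[F]_n) : monic_rV v \is monic.
Proof.
rewrite monicE lead_coefDl ?lead_coefXn //.
by rewrite size_polyXn ltnS size_poly.
Qed.

Lemma coef_monic_rV (F : nzRingType) n (v : 'rV[F]_n) (i : 'I_n) :
  (monic_rV v)`_i = v ord0 i.
Proof. by rewrite coefD coefXn ltn_eqF // add0r coef_rVpoly_ord. Qed.

Lemma monic_rV_inj (F : nzRingType) n : injective (@monic_rV F n).
Proof. by move=> u v /addrI /(can_inj rVpolyK). Qed.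

Lemma monic_rVP (F : nzRingType) n (f : {poly F}) : f \is monic -> size f = n.+1 ->
  exists v : 'rV[F]_n, f = monic_rV v.
Proof.
move=> /monicP lf sf; exists (poly_rV (f - 'X^n)).
rewrite /monic_rV poly_rV_K ?subrKC //.
apply/leq_sizeP => j jn; rewrite coefB coefXn.
have [->|jn'] := eqVneq j n; first by move: lf; rewrite lead_coefE sf /= => ->; rewrite subrr.
by rewrite nth_default ?subrr // sf; lia.
Qed.

Lemma splitting_finField (F : finFieldType) (p : {poly F}) : p != 0 ->
  exists (L : finFieldType) (iota : {rmorphism F -> L}) (s : seq L),
    map_poly iota p %= \prod_(r <- s) ('X - r%:P).
Proof.
move=> /FinSplittingFieldFor [L [s Hs _]].
by exists (FinFieldExtType L), (in_alg L), s.
Qed.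

Lemma prim_root_neq0 (R : fieldType) n (z : R) : n.-primitive_root z -> z != 0.
Proof.
move=> zp; apply/eqP => z0; have := prim_expr_order zp.
by rewrite z0 expr0n gtn_eqF ?(prim_order_gt0 zp) // => /esym/eqP; rewrite oner_eq0.
Qed.

Lemma card_finField_gt1 (F : finFieldType) : (1 < #|F|)%N.
Proof. exact: finNzRing_gt1. Qed.

Lemma card_finField_pnat (F : finFieldType) : [pchar F].-nat #|F|.
Proof.
have [p pr_p pF] := finPcharP F.
have := abelem_pgroup (fin_ring_pchar_abelem pF).
by rewrite /pgroup cardsT (eq_pnat _ (pcharf_eq pF)).
Qed.

Lemma card_finField_natr0 (F : finFieldType) : #|F|%:R = 0 :> F.
Proof. by rewrite -FinRing.zmodXgE -cardsT expg_cardG ?inE. Qed.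

(** The integer [q - 1] maps to [-1] in [F], so its divisors are invertible there. *)
Lemma natr_dvd_neq0 (F : finFieldType) n : (n %| #|F| - 1)%N -> n%:R != 0 :> F.
Proof.
move=> /dvdnP[a aE]; have : (#|F| - 1)%:R != 0 :> F.
  by rewrite natrB ?(ltnW (card_finField_gt1 F)) // card_finField_natr0 sub0r oppr_eq0 oner_eq0.
by rewrite aE natrM mulf_eq0 negb_or => /andP[].
Qed.

(** One field serves all degrees at once: [L] splits the product [A] of all monic polynomials of
    degree at most [m], times the product [B] of the [X^(q^k - 1) - 1]. *)
Lemma splitting_tower (F : finFieldType) (m : nat) :
  exists (L : finFieldType) (iota : {rmorphism F -> L}),
    (forall f : {poly F}, f \is monic -> (size f <= m.+1)%N ->
       exists s : seq L, map_poly iota f = \prod_(r <- s) ('X - r%:P)) /\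
    (forall k, (0 < k <= m)%N -> exists z : L, (#|F| ^ k - 1).-primitive_root z).
Proof.
pose A : {poly F} := \prod_(n < m.+1) \prod_(v : 'rV[F]_n) monic_rV v.
pose B : {poly F} := \prod_(k < m.+1) ('X^(#|F| ^ k.+1 - 1) - 1).
have q1 := card_finField_gt1 F.
have qk k : (0 < k -> 1 < #|F| ^ k)%N by move=> k0; rewrite -(exp1n k) ltn_exp2r.
have [] := @splitting_finField F (A * B).
  rewrite mulf_neq0 //; apply/prodf_neq0 => k _.
    by apply/prodf_neq0 => v _; rewrite monic_neq0 // monic_rV_monic.
  by rewrite monic_neq0 // monicXnsubC //; have := qk k.+1; lia.
move=> L [iota [s Hs]]; exists L, iota.
have split (f : {poly F}) : f \is monic -> f %| A * B ->
    exists s : seq L, map_poly iota f = \prod_(r <- s) ('X - r%:P).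
  move=> fm fAB.
  have : map_poly iota f %| \prod_(r <- s) ('X - r%:P).
    by rewrite -(eqp_dvdr _ Hs) dvdp_map.
  move=> /dvdp_prod_XsubC [msk Hm]; exists (mask msk s).
  apply/eqP; rewrite -eqp_monic //.
    by rewrite map_monic.
  exact: monic_prod_XsubC.
split.
  move=> f fm fs; have sf0 : (0 < size f)%N by rewrite size_poly_gt0 monic_neq0.
  have [v fv] := monic_rVP fm (esym (prednK sf0)).
  apply: split => //; apply: dvdp_mulr; rewrite /A.
  have nm : ((size f).-1 < m.+1)%N by lia.
  rewrite (bigD1 (Ordinal nm)) //= dvdp_mulr // (bigD1 v) //= -fv dvdp_mulr //.
move=> k /andP[k0 km].
have Q0 : (0 < #|F| ^ k - 1)%N by have := qk k; lia.
have [] := split ('X^(#|F| ^ k - 1) - 1).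
- exact: monicXnsubC.
- have km' : (k.-1 < m.+1)%N by lia.
  by rewrite dvdp_mull // /B (bigD1 (Ordinal km')) //= prednK // dvdp_mulr.
move=> rs; rewrite rmorphB rmorph1 rmorphXn /= map_polyX => Drs.
(* With [N = q^k - 1], the polynomial [X^N - 1] is separable since [N = -1] in [L]; [N] distinct
   [N]-th roots of unity include a primitive one. *)
have /hasP[z _ Hz] : has (#|F| ^ k - 1).-primitive_root rs.
  apply: has_prim_root => //.
  - by apply/allP => z; rewrite /root_of_unity -root_prod_XsubC -Drs.
  - rewrite -separable_prod_XsubC -Drs cyclotomic.separable_Xn_sub_1 //.
    rewrite natrB 1?ltnW ?qk // natrX.
    rewrite -(rmorph_nat iota) card_finField_natr0 rmorph0 expr0n gtn_eqF // sub0r.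
    by rewrite oppr_eq0 oner_eq0.
  rewrite -ltnS -(size_prod_XsubC rs id) -Drs size_XnsubC //.
by exists z.
Qed.

(** * The L-function of a multiplicative function on monic polynomials *)

Lemma prod_seq_count (R : comNzRingType) (I : finType) (G : I -> R) (s : seq I) :
  \prod_(x <- s) G x = \prod_x G x ^+ count_mem x s.
Proof.
elim: s => [|y s IHs]; first by rewrite big_nil big1.
rewrite big_cons IHs /=; under [RHS]eq_bigr => x _ do rewrite exprD.
rewrite big_split /=; congr (_ * _); rewrite (bigD1 y) //= eqxx expr1 big1 ?mulr1 // => x xy.
by rewrite eq_sym (negPf xy).
Qed.

Lemma dvdp_prod_XsubC_count (L : finFieldType) (s t : seq L) :
  reflect (forall x, x \in s -> count_mem x s <= count_mem x t)%N
    (\prod_(x <- s) ('X - x%:P) %| \prod_(x <- t) ('X - x%:P)).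
Proof.
apply: (iffP idP) => [dvd x _|cnt].
  rewrite -(mu_prod_XsubC x t) mup_geq; last by rewrite monic_neq0 // monic_prod_XsubC.
  apply: dvdp_trans dvd; rewrite -mup_geq ?mu_prod_XsubC //.
  by rewrite monic_neq0 // monic_prod_XsubC.
rewrite [X in X %| _]prod_seq_count [X in _ %| X]prod_seq_count.
apply: (big_ind2 (fun p q : {poly L} => p %| q)) => // [p1 q1 p2 q2|x _]; first exact: dvdp_mul.
have [xs|xs] := boolP (x \in s); first by apply/dvdp_exp2l/cnt.
by rewrite (count_memPn xs) expr0 dvd1p.
Qed.

Lemma sum_monic_dvd (F : finFieldType) (V : nmodType) (G : {poly F} -> V) n k (P : {poly F}) :
  P \is monic -> size P = k.+1 -> (k <= n)%N ->
  \sum_(v : 'rV[F]_n | P %| monic_rV v) G (monic_rV v)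
  = \sum_(w : 'rV[F]_(n - k)) G (P * monic_rV w).
Proof.
move=> Pm sP kn.
pose h (w : 'rV[F]_(n - k)) : 'rV[F]_n := poly_rV (P * monic_rV w - 'X^n).
pose h' (v : 'rV[F]_n) : 'rV[F]_(n - k) := poly_rV (monic_rV v %/ P - 'X^(n - k)).
have P0 := monic_neq0 Pm.
have hE w : monic_rV (h w) = P * monic_rV w.
  have mm : P * monic_rV w \is monic by rewrite monicMl // monic_rV_monic.
  have sm : size (P * monic_rV w) = n.+1.
    by rewrite size_monicM ?monic_neq0 ?monic_rV_monic // sP size_monic_rV; lia.
  by have [v vE] := monic_rVP mm sm; rewrite /h vE {2}/monic_rV addrC addKr rVpolyK.
have h'E v : P %| monic_rV v -> P * monic_rV (h' v) = monic_rV v.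
  move=> /dvdpP[g gE].
  have gm : g \is monic by rewrite -(monicMr _ Pm) -gE monic_rV_monic.
  have sg : size g = (n - k).+1.
    have := size_monic_rV v; rewrite gE size_Mmonic ?monic_neq0 // sP; move: (size g) => sg; lia.
  have [w wE] := monic_rVP gm sg.
  by rewrite /h' gE mulpK // wE {2}/monic_rV addrC addKr rVpolyK -wE mulrC.
rewrite (reindex_onto h h') => [|v Pv]; last by apply: monic_rV_inj; rewrite hE h'E.
apply: eq_big => [w|w _]; last by rewrite hE.
rewrite hE dvdp_mulr //=; apply/eqP/monic_rV_inj/(mulfI P0).
by rewrite h'E hE // dvdp_mulr.
Qed.

(** * Frobenius, norm polynomials and the recurrence for sums over monic polynomials *)

Section Tower.
Variables (F L : finFieldType) (iota : {rmorphism F -> L}).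

(* The morphism argument makes the ring-morphism structure inferable. *)
Definition frob of {rmorphism F -> L} := fun x : L => x ^+ #|F|.

Lemma frob_is_zmod_morphism : zmod_morphism (frob iota).
Proof.
move=> x y; rewrite /frob.
have qL : [pchar L].-nat #|F|.
  by rewrite (eq_pnat _ (fmorph_pchar iota)) card_finField_pnat.
apply/(addIr (y ^+ #|F|)); rewrite subrK.
by rewrite -exprDn_pchar // subrK.
Qed.

Lemma frob_is_monoid_morphism : monoid_morphism (frob iota).
Proof. by split=> [|x y]; rewrite /frob ?expr1n ?exprMn. Qed.

HB.instance Definition _ := GRing.isZmodMorphism.Build L L (frob iota) frob_is_zmod_morphism.
HB.instance Definition _ := GRing.isMonoidMorphism.Build L L (frob iota) frob_is_monoid_morphism.

Local Notation fr := (frob iota).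

Lemma frob_inj : injective fr.
Proof. exact: fmorph_inj. Qed.

Lemma frob_iota y : fr (iota y) = iota y.
Proof. by rewrite /frob -rmorphXn /= expf_card. Qed.

(** [X^q - X] already splits over [F], so it has no further roots in [L]. *)
Lemma frob_fixed x : fr x = x -> exists y, x = iota y.
Proof.
move=> frx; have : root (map_poly iota ('X^#|F| - 'X)) x.
  rewrite rmorphB rmorphXn /= map_polyX rootE !hornerE.
  by move: frx; rewrite /frob => ->; rewrite subrr.
rewrite finField_genPoly rmorph_prod /=.
under eq_bigr => y _ do rewrite rmorphB /= map_polyX map_polyC.
rewrite -big_enum -(big_map iota xpredT (fun r => 'X - r%:P)) root_prod_XsubC.
by case/mapP => y _ ->; exists y.
Qed.

Definition iota_inv (x : L) : F := odflt 0 [pick y | iota y == x].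

Lemma iotaK : cancel iota iota_inv.
Proof.
move=> y; rewrite /iota_inv; case: pickP => [z /eqP/fmorph_inj //|/(_ y)].
by rewrite eqxx.
Qed.

Lemma iota_invK x : fr x = x -> iota (iota_inv x) = x.
Proof. by move=> /frob_fixed[y ->]; rewrite iotaK. Qed.

Lemma iota_inv0 : iota_inv 0 = 0.
Proof. by rewrite -(rmorph0 iota) iotaK. Qed.

Lemma map_poly_iota_inv g : map_poly fr g = g -> map_poly iota (map_poly iota_inv g) = g.
Proof.
move=> frg; apply/polyP => i; rewrite coef_map /= coef_map_id0 ?iota_inv0 // iota_invK //.
by rewrite -[in RHS]frg coef_map.
Qed.

(** When [x] is fixed by the [k]-th power of Frobenius, Frobenius permutes the factors, so the
    product descends to [F]; it is the characteristic polynomial of [x] in degree [k]. *)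
Definition orbit_poly k x : {poly L} := \prod_(y <- traject fr x k) ('X - y%:P).
Definition norm_poly k x : {poly F} := map_poly iota_inv (orbit_poly k x).

Lemma map_prod_XsubC (R S : comNzRingType) (f : {rmorphism R -> S}) s :
  map_poly f (\prod_(y <- s) ('X - y%:P)) = \prod_(y <- map f s) ('X - y%:P).
Proof.
rewrite rmorph_prod big_map; apply: eq_bigr => y _.
by rewrite rmorphB /= map_polyX map_polyC.
Qed.

Lemma frob_traject k x : iter k fr x = x ->
  perm_eq (map fr (traject fr x k)) (traject fr x k).
Proof.
have map_traject n y : map fr (traject fr y n) = traject fr (fr y) n.
  by elim: n y => //= n IHn y; rewrite IHn.
by case: k => // k xk; rewrite map_traject trajectSr -iterSr xk perm_rcons.
Qed.

Lemma map_norm_poly k x : iter k fr x = x -> map_poly iota (norm_poly k x) = orbit_poly k x.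
Proof.
move=> xk; apply: map_poly_iota_inv; rewrite map_prod_XsubC.
by apply: perm_big; apply: frob_traject.
Qed.

Lemma norm_poly_monic k x : iter k fr x = x -> norm_poly k x \is monic.
Proof. by move=> xk; rewrite -(map_monic iota) map_norm_poly // monic_prod_XsubC. Qed.

Lemma size_norm_poly k x : iter k fr x = x -> size (norm_poly k x) = k.+1.
Proof.
by move=> xk; rewrite -(size_map_poly iota) map_norm_poly // size_prod_XsubC size_traject.
Qed.

Lemma count_roots_frob (f : {poly F}) (s : seq L) x :
  map_poly iota f = \prod_(r <- s) ('X - r%:P) -> count_mem (fr x) s = count_mem x s.
Proof.
move=> fs; rewrite -(mu_prod_XsubC (fr x)) -fs.
have -> : map_poly iota f = map_poly fr (map_poly iota f).
  by apply/polyP => i; rewrite !coef_map /= frob_iota.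
by rewrite fs map_prod_XsubC mu_prod_XsubC count_map; apply: eq_count => y /=; rewrite (inj_eq frob_inj).
Qed.

Lemma count_flatten_nseq (T : eqType) (x : T) j s :
  count_mem x (flatten (nseq j s)) = (j * count_mem x s)%N.
Proof. by elim: j => //= j IHj; rewrite count_cat IHj mulSn. Qed.

(* When [x] is fixed by the [k]-th power of Frobenius, [norm_poly k x] is a power of the minimal
   polynomial of [x]; so the [i] counted here are as many as the powers dividing [f]. *)
Lemma count_roots_orbit (f : {poly F}) (s : seq L) n x :
  map_poly iota f = \prod_(r <- s) ('X - r%:P) -> size s = n ->
  count_mem x s = (\sum_(i < n) ((iter i.+1 fr x == x) && (norm_poly i.+1 x %| f)%R))%N.
Proof.
move=> fs sn; set e := count_mem x s; set r := fingraph.order fr x.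
have r0 : (0 < r)%N by rewrite fingraph.order_gt0.
have orb y : y \in fingraph.orbit fr x -> count_mem y s = e.
  rewrite -fconnect_orbit => /iter_findex <-.
  by elim: (findex _ _ _) => //= i IHi; rewrite (count_roots_frob _ fs).
have flat j y : count_mem y (flatten (nseq j (fingraph.orbit fr x)))
    = (j * (y \in fingraph.orbit fr x))%N.
  by rewrite count_flatten_nseq count_uniq_mem ?orbit_uniq.
have dvd_flat j : \prod_(y <- flatten (nseq j (fingraph.orbit fr x))) ('X - y%:P)
      %| \prod_(r <- s) ('X - r%:P) = (j <= e)%N.
  apply/dvdp_prod_XsubC_count/idP => [cnt|je y yf].
    case: j cnt => // j /(_ x); rewrite flat in_orbit muln1; apply.
    by rewrite /= mem_cat in_orbit.
  rewrite flat; case: (boolP (y \in _)) => [yo|_]; last by rewrite muln0.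
  by rewrite muln1 orb.
have size_flat j : size (flatten (nseq j (fingraph.orbit fr x))) = (j * r)%N.
  by elim: j => //= j IHj; rewrite size_cat IHj size_orbit mulSn.
have er_n : (e * r <= n)%N.
  have := dvdp_leq _ (etrans (dvd_flat e) (leqnn e)).
  rewrite !(size_prod_XsubC _ id) size_flat sn ltnS; apply.
  by rewrite monic_neq0 // monic_prod_XsubC.
(* A divisor [norm_poly i.+1 x] is the [j]-th power of the minimal polynomial with [i.+1 = j * r],
   and it divides [f] exactly when [j <= e]. *)
have termE i : (iter i.+1 fr x == x) && (norm_poly i.+1 x %| f)
   = (r %| i.+1)%N && (i.+1 <= e * r)%N.
  have [xi|xi] := eqVneq (iter i.+1 fr x) x.
    rewrite -(dvdp_map iota) map_norm_poly // fs /orbit_poly.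
    have cyc : fcycle fr (x :: traject fr (fr x) i).
      rewrite /= rcons_path fpath_traject /= last_traject -iterS; exact/eqP.
    have [j trE] := fcycle_consEflatten cyc.
    rewrite [traject fr x i.+1]trE dvd_flat.
    have -> : i.+1 = (j.+1 * r)%N.
      by have := congr1 size trE; rewrite size_flat /= size_traject.
    by rewrite dvdn_mull // leq_pmul2r.
  apply/esym/negbTE; apply: contra xi => /andP[/dvdnP[j ->] _].
  apply/eqP; elim: j => [|j IHj] //; rewrite mulSn iterD IHj.
  exact: iter_order frob_inj _.
under eq_bigr => i _ do rewrite termE.
(* [e] is the number of multiples of [r] among [1, ..., e * r]; by [er_n] the terms beyond this
   range only add zeros. *)
rewrite -{1}(mulnK e r0) divn_count_dvd.
rewrite big_add1 /= -(big_mkord xpredT (fun i => nat_of_bool ((r %| i.+1) && (i < e * r))%N)).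
rewrite [RHS](big_cat_nat (n := e * r)) //= [X in _ = (_ + X)%N]big1_seq ?addn0 => [|i]; last first.
  by rewrite mem_index_iota => /andP[_ /andP[h _]]; rewrite ltnNge h andbF.
by apply: eq_big_nat => i /andP[_ h]; rewrite h andbT.
Qed.

Section Recurrence.
Variable Lam : {poly F} -> algC.
Hypothesis LamM : forall f g, f \is monic -> g \is monic -> Lam (f * g) = Lam f * Lam g.

Definition monic_sum n := \sum_(v : 'rV[F]_n) Lam (monic_rV v).
Definition norm_sum k := \sum_(x : L | iter k fr x == x) Lam (norm_poly k x).

(* The logarithmic derivative of the L-function of [Lam], compared coefficientwise. *)
Lemma monic_sum_recurrence n :
  (forall f : {poly F}, f \is monic -> size f = n.+1 ->
     exists s : seq L, map_poly iota f = \prod_(r <- s) ('X - r%:P)) ->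
  n%:R * monic_sum n = \sum_(i < n) norm_sum i.+1 * monic_sum (n - i.+1).
Proof.
move=> split; rewrite mulr_sumr.
(* The factor [n] counts the roots of each polynomial with multiplicity, and [count_roots_orbit]
   turns each multiplicity into a count of norm polynomials dividing it. *)
transitivity (\sum_(v : 'rV[F]_n) \sum_(x : L) \sum_(i < n | iter i.+1 fr x == x)
    if norm_poly i.+1 x %| monic_rV v then Lam (monic_rV v) else 0).
  apply: eq_bigr => v _.
  have [s sE] := split _ (monic_rV_monic v) (size_monic_rV v).
  have sn : size s = n.
    by apply: succn_inj; rewrite -(size_prod_XsubC s id) -sE size_map_poly size_monic_rV.
  have nE : n = (\sum_(x : L) count_mem x s)%N.
    rewrite -sn; elim: (s) => [|y t IHt] /=; first by rewrite big1.
    rewrite big_split -IHt /= (bigD1 y) //= eqxx big1 // => x xy.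
    by rewrite eq_sym (negPf xy).
  rewrite {1}nE natr_sum mulr_suml; apply: eq_bigr => x _.
  rewrite (count_roots_orbit _ sE sn) natr_sum mulr_suml [RHS]big_mkcond.
  apply: eq_bigr => i _; case: ifP => _ /=; last by rewrite mul0r.
  by case: ifP => _; rewrite ?mul1r ?mul0r.
rewrite exchange_big /=.
transitivity (\sum_(x : L) \sum_(i < n | iter i.+1 fr x == x)
   Lam (norm_poly i.+1 x) * monic_sum (n - i.+1)).
  apply: eq_bigr => x _; rewrite exchange_big /=; apply: eq_bigr => i /eqP xi.
  have Pm : norm_poly i.+1 x \is monic by apply: norm_poly_monic.
  rewrite -big_mkcond /= (sum_monic_dvd _ Pm (size_norm_poly (k := i.+1) xi)) //.
  rewrite mulr_sumr; apply: eq_bigr => w _.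
  by rewrite LamM ?monic_rV_monic.
rewrite (exchange_big_dep xpredT) //=; apply: eq_bigr => i _.
by rewrite /norm_sum mulr_suml.
Qed.

End Recurrence.

End Tower.

(** * The Hasse-Davenport product formula *)

Lemma sum_seq_count (V : zmodType) (I : finType) (G : I -> V) (s : seq I) :
  \sum_(x <- s) G x = \sum_x G x *+ count_mem x s.
Proof.
elim: s => [|y s IHs]; first by rewrite big_nil big1.
rewrite big_cons IHs /=; under [RHS]eq_bigr => x _ do rewrite mulrnDr.
rewrite big_split /=; congr (_ + _); rewrite (bigD1 y) //= eqxx big1 ?addr0 // => x xy.
by rewrite eq_sym (negPf xy).
Qed.

(** The coefficients below [m] determine the power sums below [m]; in Newton's identity at [m] only
    the two extreme terms can then differ. *)
Lemma power_sum_ext (R : comNzRingType) (s t : seq R) m : (0 < m)%N ->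
  (forall i, (i < m)%N -> (rev_prod s)`_i = (rev_prod t)`_i) ->
  power_sum s m + m%:R * (rev_prod s)`_m = power_sum t m + m%:R * (rev_prod t)`_m.
Proof.
elim/ltn_ind: m => m IHm m0 st.
have ps k : (0 < k < m)%N -> power_sum s k = power_sum t k.
  move=> /andP[k0 km]; have := IHm k km k0 (fun i ik => st i (ltn_trans ik km)).
  by rewrite st // => /addIr.
have := etrans (newton_identity s m) (esym (newton_identity t m)).
case: m m0 st ps {IHm} => // m _ st ps.
rewrite !big_ord_recl !coef0_rev_prod !mul1r !subn0.
have -> : \sum_(i < m) (rev_prod s)`_(lift ord0 i) * power_sum s (m.+1 - lift ord0 i)
        = \sum_(i < m) (rev_prod t)`_(lift ord0 i) * power_sum t (m.+1 - lift ord0 i).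
  by apply: eq_bigr => i _; rewrite lift0 st ?ps //; have := ltn_ord i; lia.
by rewrite addrAC [RHS]addrAC => /addIr.
Qed.

Record mulchar (F : finFieldType) (A : F -> algC) : Prop := MulChar {
  mulchar0 : A 0 = 0;
  mulchar1 : A 1 = 1;
  mulcharM : forall x y, A (x * y) = A x * A y }.

Record addchar (F : finFieldType) (t : F -> algC) : Prop := AddChar {
  addchar0 : t 0 = 1;
  addcharD : forall x y, t (x + y) = t x * t y;
  addchar_neq1 : exists a, t a != 1 }.

Definition gauss (F : finFieldType) (t A : F -> algC) := \sum_x A x * t x.

Lemma mulcharX (F : finFieldType) (A : F -> algC) : mulchar A ->
  forall x n, A (x ^+ n) = A x ^+ n.
Proof. by move=> [_ A1 AM] x; elim=> [|n IHn]; rewrite ?A1 // !exprS AM IHn. Qed.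

Lemma mulchar_neq0 (F : finFieldType) (A : F -> algC) : mulchar A ->
  forall x, x != 0 -> A x != 0.
Proof.
move=> [_ A1 AM] x x0; apply/eqP => Ax; have := A1.
by rewrite -(mulfV x0) AM Ax mul0r => /esym/eqP; rewrite oner_eq0.
Qed.

(** * Product and power sums of the roots, as functions of the polynomial *)

Section Roots.
Variables (F L : finFieldType) (iota : {rmorphism F -> L}).
Local Notation fr := (frob iota).

Lemma mup_frob (f : {poly F}) x : f != 0 ->
  mup (fr x) (map_poly iota f) = mup x (map_poly iota f).
Proof.
move=> f0; have g0 : map_poly iota f != 0 by rewrite map_poly_eq0.
have gE : map_poly iota f = map_poly fr (map_poly iota f).
  by apply/polyP => i; rewrite !coef_map /= frob_iota.
have XE n : ('X - (fr x)%:P) ^+ n = map_poly fr (('X - x%:P) ^+ n).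
  by rewrite [in RHS]rmorphXn [in RHS]rmorphB /= map_polyX map_polyC.
move: (map_poly iota f) g0 gE (fr x) XE => g g0 gE y XE.
have geqE n : (n <= mup y g)%N = (n <= mup x g)%N.
  apply: (etrans (mup_geq y n g0)); apply: etrans (esym (mup_geq x n g0)).
  by rewrite {1}gE XE dvdp_map.
move: (mup y g) (mup x g) geqE => u v uv.
by apply/eqP; rewrite eqn_leq -uv leqnn uv leqnn.
Qed.

(** Vieta's formula gives the product of the roots without a splitting field. *)
Definition root_prod (f : {poly F}) : F := (-1) ^+ (size f).-1 * f`_0.
(** Roots outside [L] are not seen, so this is the [e]-th power sum only when [f] splits in [L].
    Additivity on products holds in any case, and Frobenius invariance brings the sum down to
    [F]. *)
Definition root_power_sum e (f : {poly F}) : F :=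
  iota_inv iota (\sum_(x : L) x ^+ e *+ mup x (map_poly iota f)).

Lemma root_prodM f g : f \is monic -> g \is monic ->
  root_prod (f * g) = root_prod f * root_prod g.
Proof.
move=> fm gm; rewrite /root_prod coef0M size_monicM ?monic_neq0 //.
have sf : (0 < size f)%N by rewrite size_poly_gt0 monic_neq0.
have sg : (0 < size g)%N by rewrite size_poly_gt0 monic_neq0.
have -> : (size f + size g).-2 = ((size f).-1 + (size g).-1)%N.
  by move: (size f) (size g) sf sg => a b; lia.
by rewrite exprD; ring.
Qed.

Lemma iota_root_power_sum e f : f != 0 ->
  iota (root_power_sum e f) = \sum_(x : L) x ^+ e *+ mup x (map_poly iota f).
Proof.
move=> f0; rewrite iota_invK // rmorph_sum /=.
rewrite [RHS](reindex_inj (@frob_inj _ _ iota)) /=; apply: eq_bigr => x _.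
by rewrite mup_frob // rmorphMn rmorphXn.
Qed.

Lemma root_power_sumM e f g : f \is monic -> g \is monic ->
  root_power_sum e (f * g) = root_power_sum e f + root_power_sum e g.
Proof.
move=> /monic_neq0 f0 /monic_neq0 g0; apply: (fmorph_inj iota).
rewrite rmorphD /= !iota_root_power_sum ?mulf_neq0 // -big_split /=.
by apply: eq_bigr => x _; rewrite rmorphM mupM ?map_poly_eq0 // mulrnDr.
Qed.

Lemma iota_root_power_sum_split e f (s : seq L) :
  map_poly iota f = \prod_(r <- s) ('X - r%:P) ->
  iota (root_power_sum e f) = power_sum s e.
Proof.
move=> fs; have f0 : f != 0.
  by rewrite -(map_poly_eq0 iota) fs monic_neq0 // monic_prod_XsubC.
rewrite iota_root_power_sum // /power_sum [RHS]sum_seq_count fs.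
by apply: eq_bigr => x _; rewrite mu_prod_XsubC.
Qed.

Lemma iota_root_prod_split f (s : seq L) :
  map_poly iota f = \prod_(r <- s) ('X - r%:P) ->
  iota (root_prod f) = \prod_(r <- s) r.
Proof.
move=> fs; rewrite /root_prod rmorphM rmorphXn rmorphN1 /= -coef_map /= -(size_map_poly iota) fs.
rewrite (size_prod_XsubC s id) /= coef0_prod {fs}.
elim: s => [|y s IHs]; first by rewrite !big_nil mul1r.
by rewrite !big_cons /= exprS -IHs coefB coefX coefC /=; ring.
Qed.

Lemma coef_split_rev f (s : seq L) j : (j <= size s)%N ->
  map_poly iota f = \prod_(r <- s) ('X - r%:P) ->
  iota f`_(size s - j) = (rev_prod s)`_j.
Proof. by move=> js fs; rewrite -coef_map /= fs coef_prod_XsubC_rev. Qed.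

Lemma prod_traject x k : \prod_(y <- traject fr x k) y = x ^+ (\sum_(i < k) #|F| ^ i).
Proof.
elim: k x => [|k IHk] x; first by rewrite big_nil big_ord0.
rewrite /= big_cons IHk big_ord_recl expn0 exprD expr1 /frob -exprM; congr (_ * _ ^+ _).
by rewrite big_distrr /=; apply: eq_bigr => i _; rewrite -expnS.
Qed.

Lemma power_sum_traject x k e :
  power_sum (traject fr x k) e = power_sum (traject fr (x ^+ e) k) 1.
Proof.
rewrite /power_sum; elim: k x => [|k IHk] x; first by rewrite !big_nil.
by rewrite /= !big_cons IHk /frob exprAC expr1.
Qed.

Lemma iter_frobX x k e : iter k fr (x ^+ e) = iter k fr x ^+ e.
Proof. by elim: k => //= k ->; rewrite rmorphXn. Qed.

Lemma iter_frobE x k : iter k fr x = x ^+ (#|F| ^ k).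
Proof. by elim: k => //= k ->; rewrite /frob -exprM expnSr. Qed.

Lemma iota_root_prod_norm x k : iter k fr x = x ->
  iota (root_prod (norm_poly iota k x)) = x ^+ (\sum_(i < k) #|F| ^ i).
Proof.
by move=> xk; rewrite (iota_root_prod_split (map_norm_poly xk)) prod_traject.
Qed.

Lemma root_prod_normX x k e : iter k fr x = x ->
  root_prod (norm_poly iota k (x ^+ e)) = root_prod (norm_poly iota k x) ^+ e.
Proof.
move=> xk; apply: (fmorph_inj iota); rewrite rmorphXn /= !iota_root_prod_norm //.
  by rewrite exprAC.
by rewrite iter_frobX xk.
Qed.

(** The conjugates of [x ^+ e] are the [e]-th powers of the conjugates of [x]; with
    [root_prod_normX] this is the pullback under [x |-> x^e]. *)
Lemma root_power_sum_norm x k e : iter k fr x = x ->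
  root_power_sum e (norm_poly iota k x) = root_power_sum 1 (norm_poly iota k (x ^+ e)).
Proof.
move=> xk; apply: (fmorph_inj iota).
have xek : iter k fr (x ^+ e) = x ^+ e by rewrite iter_frobX xk.
rewrite (iota_root_power_sum_split e (map_norm_poly xk)).
by rewrite (iota_root_power_sum_split 1 (map_norm_poly xek)) power_sum_traject.
Qed.

End Roots.

Lemma addchar_sum0 (F : finFieldType) (t : F -> algC) : addchar t -> \sum_x t x = 0.
Proof.
move=> [t0 tD [a ta]]; apply/eqP; rewrite -(mulrI_eq0 _ (x := 1 - t a)); last first.
  by apply/lregP; rewrite subr_eq0 eq_sym.
rewrite mulrBl mul1r subr_eq0 mulr_sumr [X in X == _](reindex_inj (addrI a)) /=.
by apply/eqP/eq_bigr => x _; rewrite tD.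
Qed.

(* Both sides equal [m] times the sum of [H] over the multiples of [m] below [m * r]. *)
Lemma sum_roots_of_unity (m r : nat) (H : nat -> algC) (w : algC) : (0 < m)%N ->
  m.-primitive_root w -> (forall i, H (i + m * r)%N = H i) ->
  \sum_(i < m * r) H (m * i)%N = \sum_(j < m) \sum_(i < m * r) H i * (w ^+ i) ^+ j.
Proof.
move=> m0 wm Hper.
have Hper' i a : H (i + a * (m * r))%N = H i.
  by elim: a => [|a IHa]; rewrite ?addn0 // mulSnr addnA Hper IHa.
have L a : \sum_(i < a * r) H (m * i)%N = a%:R * \sum_(i < r) H (m * i)%N.
  elim: a => [|a IHa]; first by rewrite mul0n big_ord0 mul0r.
  rewrite mulSnr big_split_ord /= IHa -natr1 mulrDl mul1r; congr (_ + _).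
  by apply: eq_bigr => i _; rewrite mulnDr addnC mulnCA Hper'.
rewrite L exchange_big /=.
have Rr a : \sum_(i < m * a) \sum_(j < m) H i * (w ^+ i) ^+ j
    = m%:R * \sum_(i < a) H (m * i)%N.
  elim: a => [|a IHa]; first by rewrite muln0 !big_ord0 mulr0.
  rewrite mulnSr big_split_ord /= IHa big_ord_recr mulrDr /=; congr (_ + _).
  case: m m0 wm {Hper Hper' L IHa} => // m _ wm.
  rewrite big_ord_recl /= addn0.
  under eq_bigr => j _ do rewrite exprM (prim_expr_order wm) !expr1n mulr1.
  rewrite sumr_const card_ord mulr_natl -[RHS]addr0; congr (_ + _).
  apply: big1 => i _; rewrite -mulr_sumr; set v := w ^+ _.
  have v1 : v - 1 != 0.
    rewrite subr_eq0 /v -(prim_order_dvd wm) /bump add1n dvdn_addr ?dvdn_mulr //.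
    by apply/negP => /dvdn_leq; have := ltn_ord i; lia.
  have : (v - 1) * \sum_(j < m.+1) v ^+ j = 0.
    by rewrite -subrX1 /v exprAC (prim_expr_order wm) expr1n subrr.
  by move/eqP; rewrite mulf_eq0 (negPf v1) /= => /eqP ->; rewrite mulr0.
by rewrite Rr.
Qed.

(** * The product of Gauss sums as a coefficient of an L-function *)

Section HasseDavenport.
Variables (F L : finFieldType) (iota : {rmorphism F -> L}) (m : nat).
Hypothesis m_gt0 : (0 < m)%N.
Hypothesis splitL : forall f : {poly F}, f \is monic -> (size f <= m.+1)%N ->
  exists s : seq L, map_poly iota f = \prod_(r <- s) ('X - r%:P).
Hypothesis primL : forall k, (0 < k <= m)%N ->
  exists z : L, (#|F| ^ k - 1).-primitive_root z.
Variable theta : F -> algC.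
Hypothesis theta_char : addchar theta.

Local Notation fr := (frob iota).
Local Notation gs := (gauss theta).

(** This is [Lambda_e]: for [e = 1] the L-function is [1 + g(eta) u], and [e = m] is its pullback
    under [x |-> x^m]. *)
Definition root_char (eta : F -> algC) e f :=
  eta (root_prod f) ^+ e * theta (root_power_sum iota e f).

Lemma root_charM eta e f g : mulchar eta -> f \is monic -> g \is monic ->
  root_char eta e (f * g) = root_char eta e f * root_char eta e g.
Proof.
move=> [_ _ etaM] fm gm.
rewrite /root_char root_prodM // root_power_sumM // etaM exprMn (addcharD theta_char).
by rewrite mulrACA.
Qed.

Lemma root_char_rec eta e n : mulchar eta -> (n <= m)%N ->
  n%:R * monic_sum (root_char eta e) n =
  \sum_(i < n) norm_sum iota (root_char eta e) i.+1 * monic_sum (root_char eta e) (n - i.+1).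
Proof.
move=> eta_char nm; apply: monic_sum_recurrence => [f g|f fm sf]; first exact: root_charM.
by apply: splitL => //; rewrite sf.
Qed.

Lemma monic_sum0 eta e : mulchar eta -> monic_sum (root_char eta e) 0 = 1.
Proof.
move=> [_ eta1 _]; rewrite /monic_sum (big_pred1 0) => [|v]; last first.
  by apply/esym/eqP/matrixP => i [].
have -> : monic_rV (0 : 'rV[F]_0) = 1 by rewrite /monic_rV linear0 addr0 expr0.
rewrite /root_char /root_prod size_poly1 expr0 mul1r coef1 eta1 expr1n mul1r.
have -> : root_power_sum iota e 1 = 0.
  apply: (fmorph_inj iota); rewrite rmorph0 (iota_root_power_sum_split _ (s := [::])).
    by rewrite /power_sum big_nil.
  by rewrite rmorph1 big_nil.
exact: addchar0 theta_char.
Qed.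

Lemma split_monic_rV n (v : 'rV[F]_n) : (n <= m)%N ->
  exists2 s : seq L, size s = n & map_poly iota (monic_rV v) = \prod_(r <- s) ('X - r%:P).
Proof.
move=> nm; have [||s sE] := splitL (f := monic_rV v).
- exact: monic_rV_monic.
- by rewrite size_monic_rV.
exists s => //; apply: succn_inj.
by rewrite -(size_prod_XsubC s id) -sE size_map_poly size_monic_rV.
Qed.

Lemma root_power_sum1 n (v : 'rV[F]_n.+1) : (n < m)%N ->
  root_power_sum iota 1 (monic_rV v) = - v ord0 ord_max.
Proof.
move=> nm; have [s sn sE] := split_monic_rV v nm.
apply: (fmorph_inj iota); rewrite (iota_root_power_sum_split _ sE) rmorphN.
have := newton_identity s 1; rewrite big_ord1 coef0_rev_prod !mul1r => /eqP.
rewrite addr_eq0 => /eqP ->; congr (- _).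
rewrite -(coef_split_rev _ sE) ?sn // subn1 /=.
by rewrite -[n]/(nat_of_ord (@ord_max n)) coef_monic_rV.
Qed.

Lemma root_prod_monic_rV n (v : 'rV[F]_n.+1) :
  root_prod (monic_rV v) = (-1) ^+ n.+1 * v ord0 ord0.
Proof.
by rewrite /root_prod size_monic_rV -[0%N]/(nat_of_ord (@ord0 n)) coef_monic_rV.
Qed.

Lemma monic_sum1 eta : mulchar eta -> monic_sum (root_char eta 1) 1 = gs eta.
Proof.
move=> eta_char; rewrite /monic_sum /gauss.
rewrite (reindex (fun x : F => \row_(i < 1) - x : 'rV[F]_1)) /=; last first.
  exists (fun v : 'rV[F]_1 => - v ord0 ord0) => [x _|v _]; first by rewrite mxE opprK.
  by apply/matrixP => i j; rewrite mxE !ord1 opprK.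
apply: eq_bigr => x _; rewrite /root_char root_prod_monic_rV root_power_sum1 // !mxE.
by rewrite !expr1 mulN1r opprK.
Qed.

(** From degree 2 on, sum and product of the roots sit in different coefficients: translating the
    subleading one by [- a] keeps the product and multiplies the whole sum by [theta a], which is
    not 1. *)
Lemma monic_sum_ge2 eta n : (1 < n <= m)%N -> mulchar eta -> monic_sum (root_char eta 1) n = 0.
Proof.
case: n => // -[//|n] /= nm eta_char.
have [a ta] := addchar_neq1 theta_char.
have ta1 : 1 - theta a != 0 by rewrite subr_eq0 eq_sym.
apply: (mulfI ta1); rewrite mulr0 mulrBl mul1r; apply/eqP; rewrite subr_eq0; apply/eqP.
rewrite /monic_sum mulr_sumr.
rewrite [LHS](reindex_inj (addrI (\row_j (- a *+ (j == ord_max))))) /=.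
apply: eq_bigr => v _; rewrite /root_char !root_prod_monic_rV !root_power_sum1 // !mxE.
by rewrite mulr0n add0r eqxx opprD opprK (addcharD theta_char) !expr1 mulrCA.
Qed.

(** The Hasse-Davenport lifting relation: since the L-function is [1 + g(eta) u], only degrees 0 and
    1 survive in the recurrence. *)
Lemma norm_sum1E eta k : (0 < k <= m)%N -> mulchar eta ->
  norm_sum iota (root_char eta 1) k = - (- gs eta) ^+ k.
Proof.
move=> + eta_char; elim: k => // k IHk km.
have := root_char_rec 1 eta_char km.
rewrite big_ord_recr /= subnn monic_sum0 // mulr1.
case: k IHk km => [|k] IHk km.
  by rewrite big_ord0 add0r mul1r monic_sum1 // expr1 opprK.
rewrite monic_sum_ge2 // mulr0 big_ord_recr big1 /=; last first.
  move=> i _; rewrite monic_sum_ge2 ?mulr0 //; have := ltn_ord i; lia.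
have km' : (0 < k.+1 <= m)%N by move: km => /ltnW.
rewrite add0r subSnn (monic_sum1 eta_char) (IHk km').
move: (norm_sum _ _ _) (gs eta) => S g /esym/eqP.
rewrite addrC addr_eq0 => /eqP ->.
by rewrite [in RHS]exprSr mulrN mulNr.
Qed.

Variable chi : F -> algC.
Hypothesis chi_char : mulchar chi.
Hypothesis chi_prim : forall y : F, (#|F| - 1).-primitive_root y -> m.-primitive_root (chi y).

Lemma mulchar_twist eta j : mulchar eta -> mulchar (fun x => eta x * chi x ^+ j).
Proof.
move=> [e0 e1 eM]; case: chi_char => c0 c1 cM; split=> [||x y].
- by rewrite e0 mul0r.
- by rewrite e1 c1 expr1n mul1r.
by rewrite eM cM exprMn mulrACA.
Qed.

Lemma sum_frob_fixed (H : L -> algC) k z : (0 < k)%N -> (#|F| ^ k - 1).-primitive_root z ->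
  H 0 = 0 -> \sum_(x | iter k fr x == x) H x = \sum_(i < #|F| ^ k - 1) H (z ^+ i).
Proof.
move=> k0 zp H0; set N := (#|F| ^ k - 1)%N in zp *.
have qk : (#|F| ^ k = N.+1)%N.
  by rewrite /N subn1 prednK // expn_gt0 ltnW ?card_finField_gt1.
have N0 : (0 < N)%N := prim_order_gt0 zp.
rewrite (bigID (fun x => x == 0)) /= [X in X + _]big1 ?add0r => [|x /andP[_ /eqP ->] //].
have fixE x : (iter k fr x == x) && (x != 0) = (x ^+ N == 1).
  rewrite iter_frobE qk exprS; have [->|x0] := eqVneq x 0.
    by rewrite andbF expr0n gtn_eqF // eq_sym oner_eq0.
  by rewrite andbT -[X in _ == X]mulr1 (inj_eq (mulfI x0)).
rewrite (eq_bigl _ _ fixE).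
rewrite -(big_map (fun i : 'I_N => z ^+ i) xpredT H) -big_filter.
apply: perm_big; apply: uniq_perm.
- by rewrite filter_uniq // index_enum_uniq.
- rewrite map_inj_uniq ?index_enum_uniq // => i j /eqP.
  rewrite (eq_prim_root_expr zp) !modn_small // => /eqP; exact: val_inj.
move=> x; rewrite mem_filter mem_index_enum andbT; apply/idP/mapP => [/eqP|[i _ ->]].
  by move=> /(prim_rootP zp)[i ->]; exists i => //; rewrite mem_index_enum.
by rewrite exprAC (prim_expr_order zp) expr1n.
Qed.

(** The left side sums [H (x ^+ m)] over the fixed points of the [k]-th power of Frobenius. The
    number of [m]-th roots of a nonzero fixed point [y] is the sum over [j < m] of [chi^j] at the
    norm of [y]. *)
Lemma norm_sum_twist eta k : (0 < k <= m)%N -> mulchar eta ->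
  norm_sum iota (root_char eta m) k =
  \sum_(j < m) norm_sum iota (root_char (fun x => eta x * chi x ^+ j) 1) k.
Proof.
move=> km eta_char; have /andP[k0 _] := km; have [z zp] := primL km.
pose H x := root_char eta 1 (norm_poly iota k x).
pose N x := root_prod (norm_poly iota k x).
have N0 : N 0 = 0.
  apply: (fmorph_inj iota); rewrite rmorph0 iota_root_prod_norm.
    by rewrite expr0n; case: (k) k0 => // k' _; rewrite big_ord_recl expn0.
  by elim: (k) => //= i ->; rewrite rmorph0.
have H0 : H 0 = 0 by rewrite /H /root_char -/(N 0) N0 (mulchar0 eta_char) mul0r.
have lhs : norm_sum iota (root_char eta m) k = \sum_(x | iter k fr x == x) H (x ^+ m).
  apply: eq_bigr => x /eqP xk; rewrite /H /root_char expr1 -root_power_sum_norm // root_prod_normX //.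
  by rewrite mulcharX.
have rhs j : norm_sum iota (root_char (fun x => eta x * chi x ^+ j) 1) k =
    \sum_(x | iter k fr x == x) H x * chi (N x) ^+ j.
  by apply: eq_bigr => x _; rewrite /H /root_char !expr1 mulrAC.
rewrite lhs (sum_frob_fixed k0 zp) ?expr0n ?gtn_eqF //.
under [RHS]eq_bigr => j _ do rewrite rhs (sum_frob_fixed k0 zp) ?H0 ?mul0r //.
have zk i : iter k fr (z ^+ i) = z ^+ i.
  rewrite iter_frobX; congr (_ ^+ _); rewrite iter_frobE.
  have -> : (#|F| ^ k = (#|F| ^ k - 1).+1)%N.
    by rewrite subn1 prednK // expn_gt0 ltnW ?card_finField_gt1.
  by rewrite exprS (prim_expr_order zp) mulr1.
(* The norm raises [z] to the power [(q^k - 1) / (q - 1)], so it sends a generator to a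
   generator. *)
have Nz : (#|F| - 1).-primitive_root (N z).
  rewrite -(fmorph_primitive_root iota) iota_root_prod_norm; last exact: zk 1%N.
  set G := (\sum_(i < k) _)%N.
  have GE : (#|F| ^ k - 1 = (#|F| - 1) * G)%N by rewrite !subn1 predn_exp.
  have G0 : (0 < G)%N by move: (prim_order_gt0 zp); rewrite GE muln_gt0 => /andP[].
  have := exp_prim_root zp G.
  by rewrite GE (gcdn_idPl (dvdn_mull _ (dvdnn G))) mulnK.
have wp := chi_prim Nz.
have NzX i : N (z ^+ i) = N z ^+ i by rewrite /N root_prod_normX //; exact: zk 1%N.
have [r rE] : exists r, (#|F| ^ k - 1 = m * r)%N.
  have /dvdnP[a aE] : (m %| #|F| - 1)%N.
    by rewrite (prim_order_dvd wp) -(mulcharX chi_char) (prim_expr_order Nz) (mulchar1 chi_char).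
  exists (a * \sum_(i < k) #|F| ^ i)%N.
  by rewrite mulnA [(m * a)%N]mulnC -aE !subn1 predn_exp.
rewrite rE.
under [LHS]eq_bigr => i _ do rewrite -exprM mulnC.
under [RHS]eq_bigr => j _ do under eq_bigr => i _ do rewrite NzX (mulcharX chi_char).
apply: (@sum_roots_of_unity m r (fun i => H (z ^+ i))) => // i.
by rewrite exprD -rE (prim_expr_order zp) mulr1.
Qed.

(** The numbers [- g j] have the negated norm sums as power sums, so Newton's identities and the
    recurrence define the same sequence: the coefficients of the product of the [1 + g j u]. The
    case of degree [m] is the claim. *)
Lemma prod_gauss_monic_sum eta : mulchar eta ->
  \prod_(j < m) gs (fun x => eta x * chi x ^+ j) = monic_sum (root_char eta m) m.
Proof.
move=> eta_char.
pose g (j : 'I_m) := gs (fun x => eta x * chi x ^+ j).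
pose s := [seq - g j | j <- enum 'I_m].
have sm : size s = m by rewrite size_map size_enum_ord.
have pE k : (0 < k <= m)%N -> power_sum s k = - norm_sum iota (root_char eta m) k.
  move=> km; rewrite /power_sum /s big_map big_enum norm_sum_twist // -sumrN.
  by apply: eq_bigr => j _; rewrite norm_sum1E ?opprK //; exact: mulchar_twist.
have cE i : (i <= m)%N -> monic_sum (root_char eta m) i = (rev_prod s)`_i.
  elim/ltn_ind: i => -[|i] IHi im; first by rewrite monic_sum0 // coef0_rev_prod.
  have i0 : i.+1%:R != 0 :> algC by rewrite pnatr_eq0.
  apply: (mulfI i0); rewrite root_char_rec //.
  have /eqP := newton_identity s i.+1; rewrite addrC addr_eq0 => /eqP ->.
  rewrite -sumrN (reindex_inj rev_ord_inj) /=; apply: eq_bigr => j _.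
  have jm := ltn_ord j.
  rewrite IHi; [|lia|lia].
  have -> : (i.+1 - (i.+1 - j.+1).+1 = j)%N by lia.
  have -> : (i.+1 - j.+1).+1 = (i.+1 - j)%N by lia.
  by rewrite pE ?mulrN ?opprK 1?mulrC //; lia.
rewrite cE // -[m in _`_m]sm -coef_prod_XsubC_rev // subnn coef0_prod /s big_map big_enum.
by apply: eq_bigr => j _; rewrite coefB coefX coefC sub0r opprK.
Qed.

(** One representative, with zero constant term, for each class of polynomials modulo constants; no
    value of [eta] enters. *)
Definition top_constant : algC :=
  \sum_(v : 'rV[F]_m | (monic_rV v)`_0 == 0) theta (root_power_sum iota m (monic_rV v)).

(* Changing the constant coefficient of a degree [m] polynomial by [c] changes its [m]-th power
   sum of roots by [- m c]: this makes the top coefficient factor. *)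
Lemma monic_sum_top eta : mulchar eta ->
  monic_sum (root_char eta m) m =
  top_constant * \sum_c eta ((-1) ^+ m * c) ^+ m * theta (- (m%:R * c)).
Proof.
move=> eta_char; rewrite /top_constant /monic_sum.
have splitm := fun v : 'rV[F]_m => split_monic_rV v (leqnn m).
case: m m_gt0 splitm => // n _ splitm.
have coef0 (v : 'rV[F]_n.+1) : (monic_rV v)`_0 = v ord0 ord0.
  by rewrite -[0%N]/(nat_of_ord (@ord0 n)) coef_monic_rV.
rewrite (partition_big (fun v : 'rV[F]_n.+1 => v ord0 ord0) xpredT) //= mulr_sumr.
apply: eq_bigr => c _; under [in RHS]eq_bigl => v do rewrite coef0.
pose sh : 'rV[F]_n.+1 := \row_j (c *+ (j == ord0)).
rewrite (reindex_inj (addrI sh)) /= mulr_suml.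
apply: eq_big => [v|v /eqP]; first by rewrite !mxE eqxx -subr_eq0 addrAC subrr add0r.
rewrite !mxE eqxx => /(canRL (addKr _)); rewrite addNr => v0.
rewrite /root_char root_prod_monic_rV !mxE eqxx v0 addr0 mulrCA; congr (_ * _).
rewrite -(addcharD theta_char); congr theta.
have [s ss sE] := splitm v; have [t tt tE] := splitm (sh + v).
apply: (fmorph_inj iota); rewrite (iota_root_power_sum_split _ tE).
rewrite rmorphD rmorphN rmorphM rmorph_nat (iota_root_power_sum_split _ sE).
have coefE i : (i < n.+1)%N -> (rev_prod t)`_i = (rev_prod s)`_i.
  move=> im; rewrite -(coef_split_rev _ tE) ?tt; last exact: ltnW.
  rewrite -(coef_split_rev _ sE) ?ss; last exact: ltnW.
  case: i im => [|i] im.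
    by rewrite !coefD !coefXn !subn0 eqxx !nth_default ?size_poly.
  have jn : (n.+1 - i.+1 < n.+1)%N by lia.
  rewrite -[(n.+1 - i.+1)%N]/(nat_of_ord (Ordinal jn)) !coef_monic_rV !mxE.
  have -> : (Ordinal jn == ord0) = false by apply/negbTE; rewrite -val_eqE /=; lia.
  by rewrite mulr0n add0r.
have := power_sum_ext (ltn0Sn n) coefE.
rewrite -(coef_split_rev _ tE) ?tt // -(coef_split_rev _ sE) ?ss // subnn !coef0 !mxE v0.
by rewrite eqxx addr0 rmorph0 mulr0 addr0 => <-; rewrite addrK.
Qed.

Lemma prod_gauss_eq eta : mulchar eta -> m%:R != 0 :> F ->
  \prod_(j < m) gs (fun x => eta x * chi x ^+ j) =
  top_constant * (eta m%:R ^+ m)^-1 * gs (fun x => eta x ^+ m).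
Proof.
move=> eta_char mF; rewrite prod_gauss_monic_sum // monic_sum_top // -mulrA; congr (_ * _).
case: (eta_char) => e0 e1 eM.
have em : eta m%:R != 0 := mulchar_neq0 eta_char mF.
have mN : - m%:R != 0 :> F by rewrite oppr_eq0.
rewrite /gauss [in RHS](reindex_inj (mulfI mN)) mulr_sumr; apply: eq_bigr => c _.
rewrite mulNr mulrA; congr (_ * _); rewrite -[- (_ * c)]mulN1r !eM.
have eN1 : eta (-1) ^+ 2 = 1 by rewrite expr2 -eM mulrNN mulr1.
(* [eta (-1)] is a sign and [m * m] has the parity of [m], so the sign from Vieta's formula matches
   the one from the substitution of [- m c]. *)
have eNm : eta ((-1) ^+ m) ^+ m = eta (-1) ^+ m.
  rewrite mulcharX // -exprM; move/eqP: eN1; rewrite sqrf_eq1 => /orP[] /eqP ->.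
    by rewrite !expr1n.
  by rewrite -signr_odd oddM andbb signr_odd.
rewrite !exprMn eNm; have := expf_neq0 m em.
by move: (eta _ ^+ m) (eta _ ^+ m) (eta _ ^+ m) => u1 u2 u3 u0; field.
Qed.

End HasseDavenport.

Lemma finField_prim_root (F : finFieldType) : exists g : F, (#|F| - 1).-primitive_root g.
Proof.
have q1 := card_finField_gt1 F.
pose rs := [seq x <- enum F | x != 0].
have rs_size : size rs = (#|F| - 1)%N.
  rewrite subn1 -(cardC1 (0 : F)) cardE; apply: perm_size.
  apply: uniq_perm; [exact/filter_uniq/enum_uniq | exact: enum_uniq | move=> x].
  by rewrite mem_filter !mem_enum andbT.
have /hasP[g _ gP] : has (#|F| - 1).-primitive_root rs.
  apply: has_prim_root; first by lia.
  - apply/allP => x; rewrite mem_filter => /andP[x0 _].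
    apply/unity_rootP/(mulfI x0); rewrite -exprS mulr1 subn1 prednK ?expf_card //.
    exact: ltnW.
  - by rewrite filter_uniq // enum_uniq.
  by rewrite rs_size.
by exists g.
Qed.

Lemma exists_addchar (F : finFieldType) : exists theta : F -> algC, addchar theta.
Proof.
pose G := [set: F]%G; have abG : abelian G by apply: FinRing.zmod_abelian.
have [i i0] : exists i : Iirr G, i != 0.
  have : (1 < #|Iirr G|)%N by rewrite card_Iirr_abelian // cardsT card_finField_gt1.
  move=> /card_gt1P[i [j [_ _ ij]]]; have [i0|i0] := eqVneq i 0; last by exists i.
  by exists j; rewrite -i0 eq_sym.
have lin : 'chi_i \is a linear_char by apply/char_abelianP.
exists 'chi_i; split.
- exact: lin_char1.
- by move=> x y; rewrite -[x + y]/(x * y)%g lin_charM ?inE.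
apply/existsP; apply: contraR i0 => /existsPn chi1.
apply/eqP/irr_inj; rewrite irr0; apply/cfunP => x.
by rewrite cfun1E inE; apply/eqP; rewrite -[_ == _]negbK chi1.
Qed.

Section HD.
Variables (F : finFieldType) (m : nat) (theta chi : F -> algC).
Hypothesis m_gt0 : (0 < m)%N.
Hypothesis theta_char : addchar theta.
Hypothesis chi_char : mulchar chi.
Hypothesis chi_prim : forall y : F, (#|F| - 1).-primitive_root y -> m.-primitive_root (chi y).

(** The constant is only asserted to be the same for all [eta], its expression involving the
    auxiliary field; it is evaluated afterwards at the trivial character. *)
Lemma Hasse_Davenport_product : exists C : algC, forall eta, mulchar eta ->
  \prod_(j < m) gauss theta (fun x => eta x * chi x ^+ j) =
  C * (eta m%:R ^+ m)^-1 * gauss theta (fun x => eta x ^+ m).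
Proof.
have [L [iota [split prim]]] := splitting_tower F m.
exists (top_constant iota m theta) => eta eta_char.
apply: prod_gauss_eq => //.
have [y yp] := finField_prim_root F.
have wp := chi_prim yp.
by apply: natr_dvd_neq0; rewrite (prim_order_dvd wp) -mulcharX // (prim_expr_order yp) mulchar1.
Qed.
End HD.

(** * Gauss and Jacobi sums of powers of a generating character *)

Section Powers.
Variables (F : finFieldType) (theta t : F -> algC) (g : F).
Hypothesis theta_char : addchar theta.
Hypothesis t_char : mulchar t.
Hypothesis g_prim : (#|F| - 1).-primitive_root g.
Hypothesis tg_prim : (#|F| - 1).-primitive_root (t g).

Local Notation Q := (#|F| - 1)%N.
Local Notation q := #|F|.

(** Integer exponents let [- k] stand for the inverse character; the separate case at 0 makes the
    trivial character vanish there too. *)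
Definition cpow (k : int) (x : F) : algC := if x == 0 then 0 else t x ^ k.
Definition gauss_pow k := gauss theta (cpow k).
Definition jacobi_pow k l := \sum_x cpow k x * cpow l (1 - x).
Local Notation G := gauss_pow.
Local Notation J := jacobi_pow.

Lemma nonzero_log x : x != 0 -> exists i : nat, x = g ^+ i.
Proof.
move=> x0; have : x ^+ Q = 1.
  by apply: (mulfI x0); rewrite -exprS mulr1 subn1 prednK ?expf_card // (ltnW (card_finField_gt1 F)).
by move=> /(prim_rootP g_prim)[i ->]; exists i.
Qed.

Lemma mulchar_exp_order x : x != 0 -> t x ^+ Q = 1.
Proof.
by move=> /nonzero_log[i ->]; rewrite (mulcharX t_char) exprAC (prim_expr_order tg_prim) expr1n.
Qed.

Lemma cpow0 k : cpow k 0 = 0. Proof. by rewrite /cpow eqxx. Qed.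

Lemma cpow_mulchar k : mulchar (cpow k).
Proof.
split; first exact: cpow0.
- by rewrite /cpow oner_eq0 (mulchar1 t_char) exp1rz.
move=> x y; rewrite /cpow mulf_eq0 (mulcharM t_char).
have [->|x0] := eqVneq x 0; first by rewrite mul0r.
by have [->|y0] := eqVneq y 0; rewrite ?mulr0 //= expfzMl.
Qed.

Lemma cpowD k l x : cpow (k + l) x = cpow k x * cpow l x.
Proof.
by rewrite /cpow; case: eqVneq => [_|x0]; rewrite ?mul0r // expfzDr // (mulchar_neq0 t_char).
Qed.

Lemma cpowN k x : cpow (- k) x = (cpow k x)^-1.
Proof. by rewrite /cpow; case: eqVneq; rewrite ?invr0 // invr_expz. Qed.

Lemma cpow_neq0 k x : x != 0 -> cpow k x != 0.
Proof. by move=> x0; rewrite /cpow (negPf x0) expfz_neq0 // (mulchar_neq0 t_char). Qed.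

Lemma cpowMn k n x : (0 < n)%N -> cpow (k *+ n) x = cpow k x ^+ n.
Proof.
elim: n => // -[|n] IHn _; first by rewrite mulr1n expr1.
by rewrite mulrS cpowD IHn // -exprS.
Qed.

Lemma cpow_eps k x : (Q %| k)%Z -> cpow k x = (x != 0)%:R.
Proof.
move=> /dvdzP[a ->]; rewrite /cpow; case: eqVneq => //= x0.
by rewrite mulrC -exprz_exp -exprnP mulchar_exp_order // exp1rz.
Qed.

Lemma cpow_mod k l x : (Q %| k - l)%Z -> cpow k x = cpow l x.
Proof.
move=> kl; rewrite -[k](subrK l) cpowD cpow_eps //.
by have [->|_] := eqVneq x 0; rewrite ?cpow0 ?mulr0 // mul1r.
Qed.

Lemma G_mod k l : (Q %| k - l)%Z -> G k = G l.
Proof. by move=> kl; apply: eq_bigr => x _; rewrite (cpow_mod _ kl). Qed.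

Lemma cpow_sum k : \sum_x cpow k x = if (Q %| k)%Z then Q%:R else 0.
Proof.
have q1 := card_finField_gt1 F.
case: ifP => [Qk|Qk].
  under eq_bigr => x _ do rewrite cpow_eps //.
  rewrite -natr_sum subn1 -(cardC1 (0 : F)) -sum1_card [X in _ = X%:R]big_mkcond /=.
  by congr (_%:R); apply: eq_bigr => x _; rewrite inE; case: (x == 0).
have g0 : g != 0 := prim_root_neq0 g_prim.
have ne : cpow k g != 1.
  rewrite /cpow (negPf g0); apply/eqP => tk; move/negP: Qk; apply.
  rewrite dvdzE /= (prim_order_dvd tg_prim); apply/eqP.
  case: k tk => n; rewrite ?NegzE -?exprnP //= => tk.
  by apply: invr_inj; rewrite invr1 -tk.
have ne' : 1 - cpow k g != 0 by rewrite subr_eq0 eq_sym.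
apply: (mulfI ne'); rewrite mulr0 mulrBl mul1r; apply/eqP; rewrite subr_eq0; apply/eqP.
rewrite [LHS](reindex_inj (mulfI g0)) mulr_sumr; apply: eq_bigr => x _.
by rewrite (mulcharM (cpow_mulchar k)).
Qed.

Lemma G_eps k : (Q %| k)%Z -> G k = -1.
Proof.
move=> Qk; have := addchar_sum0 theta_char.
rewrite (bigD1 0) //= (addchar0 theta_char) => /eqP; rewrite addrC addr_eq0 => /eqP <-.
rewrite /gauss_pow /gauss (bigD1 0) //= cpow0 mul0r add0r; apply: eq_bigr => x x0.
by rewrite cpow_eps // x0 mul1r.
Qed.

(** Group the double sum by [s = x + y]: for [s != 0] rescaling by [s] yields the Jacobi sum, and
    [s = 0] yields the correction, present only when the product character is trivial. *)
Lemma G_mul k l :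
  G k * G l = J k l * G (k + l) + (if (Q %| k + l)%Z then cpow l (-1) * Q%:R else 0).
Proof.
pose I s := \sum_x cpow k x * cpow l (s - x).
have -> : G k * G l = \sum_s theta s * I s.
  rewrite /gauss_pow /gauss mulr_suml.
  under eq_bigr => x _ do rewrite mulr_sumr (reindex_inj (addIr (- x))) /=.
  rewrite exchange_big /=; apply: eq_bigr => s _; rewrite mulr_sumr; apply: eq_bigr => x _.
  rewrite mulrACA -(addcharD theta_char) subrKC mulrC; done.
have IE s : I s = cpow (k + l) s * J k l + (s == 0)%:R * (cpow l (-1) * \sum_x cpow (k + l) x).
  rewrite /I; have [->|s0] := eqVneq s 0.
    rewrite cpow0 mul0r add0r mul1r mulr_sumr; apply: eq_bigr => x _.
    by rewrite sub0r -[- x]mulN1r (mulcharM (cpow_mulchar l)) cpowD mulrCA.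
  rewrite mul0r addr0 (reindex_inj (mulfI s0)) mulr_sumr; apply: eq_bigr => x _ /=.
  rewrite -{2}[s]mulr1 -mulrBr !(mulcharM (cpow_mulchar _)) cpowD; ring.
under eq_bigr => s _ do rewrite IE mulrDr.
rewrite big_split /=; congr (_ + _).
  by rewrite /gauss_pow /gauss mulr_sumr; apply: eq_bigr => s _; ring.
rewrite (bigD1 0) //= [X in _ + X]big1 => [|s s0]; last by rewrite (negPf s0) mul0r mulr0.
rewrite addr0 eqxx (addchar0 theta_char) !mul1r cpow_sum.
by case: ifP => _; rewrite ?mulr0.
Qed.

(** Substituting [x = y u] leaves a sum of [theta (y * (1 + u))] over [y != 0], equal to [q - 1] at
    [u = -1] and to [-1] elsewhere; the constant [-1] is killed by summing the nontrivial character
    over [u]. *)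
Lemma G_conj k : ~~ (Q %| k)%Z -> G k * G (- k) = cpow k (-1) * q%:R.
Proof.
move=> Qk.
have mulE : G k * G (- k) = \sum_y \sum_u (y != 0)%:R * cpow k u * theta (y * (1 + u)).
  rewrite /gauss_pow /gauss mulr_sumr; apply: eq_bigr => y _; rewrite mulr_suml.
  have [->|y0] := eqVneq y 0.
    by rewrite big1 => [|x _]; rewrite ?cpow0 ?mul0r ?mulr0 // big1 // => u _; rewrite !mul0r.
  rewrite (reindex_inj (mulfI y0)); apply: eq_bigr => u _ /=.
  rewrite (mulcharM (cpow_mulchar k)) mulrACA -(addcharD theta_char) cpowN.
  rewrite mul1r (mulrAC _ (cpow k u)) mulfV ?cpow_neq0 // mul1r; congr (_ * theta _); ring.
rewrite mulE exchange_big /=.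
have inner u : \sum_y (y != 0)%:R * cpow k u * theta (y * (1 + u))
    = cpow k u * ((u == -1)%:R * q%:R - 1).
  have -> : \sum_y (y != 0)%:R * cpow k u * theta (y * (1 + u))
     = cpow k u * (\sum_y theta (y * (1 + u)) - 1).
    rewrite (bigD1 0) //= eqxx !mul0r add0r [in RHS](bigD1 0) //= mul0r (addchar0 theta_char).
    rewrite addrAC subrr add0r mulr_sumr; apply: eq_bigr => y y0; by rewrite y0 mul1r.
  congr (_ * (_ - 1)); have -> : (u == -1) = (1 + u == 0) by rewrite addrC addr_eq0.
  have [u0|u0] := eqVneq (1 + u) 0.
    by under eq_bigr => y _ do rewrite u0 mulr0 (addchar0 theta_char); rewrite sumr_const mul1r.
  rewrite mul0r; apply: etrans (addchar_sum0 theta_char).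
  by rewrite [RHS](reindex_inj (mulIf u0)).
under eq_bigr => u _ do rewrite inner mulrBr mulr1.
rewrite sumrB cpow_sum (negPf Qk) subr0 (bigD1 (-1)) //= eqxx mul1r big1 ?addr0 // => u u1.
by rewrite (negPf u1) mul0r mulr0.
Qed.

Lemma cpowN1_sqr k : cpow k (-1) ^+ 2 = 1.
Proof. by rewrite expr2 -(mulcharM (cpow_mulchar k)) mulrNN mulr1 (mulchar1 (cpow_mulchar k)). Qed.

Lemma cpow_evenN1 k : cpow (k + k) (-1) = 1.
Proof. by rewrite cpowD -expr2 cpowN1_sqr. Qed.

Lemma card_natr_neq0 : q%:R != 0 :> algC.
Proof. by rewrite pnatr_eq0 -lt0n (ltnW (card_finField_gt1 F)). Qed.

Lemma G_neq0 k : G k != 0.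
Proof.
have [Qk|Qk] := boolP (Q %| k)%Z; first by rewrite G_eps // oppr_eq0 oner_eq0.
have : G k * G (- k) != 0.
  rewrite G_conj // mulf_neq0 ?card_natr_neq0 // cpow_neq0 // oppr_eq0 oner_eq0 //.
by rewrite mulf_eq0 negb_or => /andP[].
Qed.

Lemma J_G k l : ~~ (Q %| k + l)%Z -> J k l = G k * G l / G (k + l).
Proof. by move=> kl; rewrite G_mul (negPf kl) addr0 mulfK ?G_neq0. Qed.

Lemma jbin_cpow A B k l : A =1 cpow k -> B =1 cpow l ->
  jbin A B = cpow l (-1) / q%:R * J k (- l).
Proof.
move=> Ak Bl; rewrite /jbin Bl; congr (_ * _); apply: eq_bigr => x _.
by rewrite Ak Bl cpowN.
Qed.

Lemma phiq_cpow (k : nat) : (k + k)%N = Q -> @phiq F =1 cpow k%:Z.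
Proof.
move=> kQ x; rewrite /phiq /cpow; case: eqVneq => // x0; rewrite -exprnP.
have [i xi] := nonzero_log x0.
case: existsP => [[y /eqP yx]|nsq].
  have y0 : y != 0 by apply: contraNneq x0 => y0; rewrite -yx y0 expr0n.
  by rewrite -yx (mulcharX t_char) -exprM mul2n -addnn kQ mulchar_exp_order.
have : (t x ^+ k) ^+ 2 == 1 by rewrite -exprM muln2 -addnn kQ mulchar_exp_order.
rewrite sqrf_eq1 => /orP[] /eqP tk //; case: nsq.
have : (Q %| i * k)%N by rewrite (prim_order_dvd tg_prim) exprM -(mulcharX t_char) -xi tk.
have k0 : (0 < k)%N by have := prim_order_gt0 g_prim; lia.
rewrite -kQ addnn -mul2n dvdn_pmul2r // => /dvdnP[j ij].
by exists (g ^+ j); rewrite xi ij exprM.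
Qed.

Lemma sum_cpow_nat x : \sum_(k < Q) cpow k%:Z x = (x == 1)%:R * Q%:R.
Proof.
have [->|x0] := eqVneq x 0.
  by rewrite big1 => [|k _]; rewrite ?cpow0 // eq_sym oner_eq0 mul0r.
have [->|x1] := eqVneq x 1.
  under eq_bigr => k _ do rewrite (mulchar1 (cpow_mulchar _)).
  by rewrite sumr_const card_ord mul1r.
rewrite mul0r; under eq_bigr => k _ do rewrite /cpow (negPf x0) -exprnP.
have tx1 : t x - 1 != 0.
  rewrite subr_eq0; apply: contra x1; have [i ->] := nonzero_log x0.
  by rewrite (mulcharX t_char) -(prim_order_dvd tg_prim) (prim_order_dvd g_prim).
by apply: (mulfI tx1); rewrite mulr0 -subrX1 mulchar_exp_order // subrr.
Qed.

End Powers.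

(** * Pairing opposite factors of finite products *)

Section Products.
Variable (R : comNzRingType) (f : nat -> R) (r : nat).

Lemma prod_iota_middle :
  f r.+1 * \prod_(j <- iota 1 (2 * r + 1) | j != r.+1) f j = \prod_(1 <= j < 2 * r + 2) f j.
Proof.
have -> : index_iota 1 (2 * r + 2) = iota 1 (2 * r + 1) by rewrite /index_iota addn2 addn1.
have rmem : r.+1 \in iota 1 (2 * r + 1) by rewrite mem_iota; lia.
by rewrite [RHS](bigD1_seq r.+1 rmem) ?iota_uniq.
Qed.

Lemma prod_pairs_odd :
  \prod_(1 <= j < 2 * r + 1) f j = \prod_(1 <= j < r.+1) (f j * f (2 * r + 1 - j)%N).
Proof.
rewrite (big_cat_nat (n := r.+1)) /=; [|by []|lia].
rewrite big_split /=; congr (_ * _).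
rewrite big_nat_rev /= -[r.+1]add1n big_addn.
have -> : (2 * r + 1 - r = r.+1)%N by lia.
by rewrite add1n; apply: eq_big_nat => j jr; congr f; lia.
Qed.

Lemma prod_pairs_middle :
  \prod_(j <- iota 1 (2 * r + 1) | j != r.+1) f j
  = \prod_(1 <= j < r.+1) (f j * f (2 * r + 2 - j)%N).
Proof.
have -> : iota 1 (2 * r + 1) = iota 1 r ++ r.+1 :: iota r.+2 r.
  have -> : (2 * r + 1 = r + r.+1)%N by lia.
  by rewrite iotaD add1n.
rewrite big_cat big_cons eqxx /= big_split /=; congr (_ * _).
  rewrite /index_iota subn1 /= big_seq_cond [RHS]big_seq; apply: eq_bigl => j.
  by rewrite mem_iota; lia.
have -> : iota r.+2 r = index_iota r.+2 (2 * r + 2).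
  by rewrite /index_iota; congr iota; lia.
have condE j : (j \in index_iota r.+2 (2 * r + 2)) && (j != r.+1)
    = (j \in index_iota r.+2 (2 * r + 2)) by rewrite mem_index_iota; lia.
rewrite big_seq_cond (eq_bigl _ _ condE) -big_seq big_nat_rev /= -[r.+2]/(1 + r.+1)%N big_addn.
have -> : (2 * r + 2 - r.+1 = r.+1)%N by lia.
by apply: eq_big_nat => j jr; congr f; lia.
Qed.

Lemma prod_rev_iota :
  \prod_(1 <= j < 2 * r + 2) f j = \prod_(i < 2 * r + 1) f (2 * r + 1 - i)%N.
Proof.
rewrite big_nat_rev /= big_add1 -(big_mkord xpredT (fun i => f (2 * r + 1 - i)%N)).
have -> : (2 * r + 2).-1 = (2 * r + 1)%N by lia.
by apply: eq_big_nat => j jr; congr f; lia.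
Qed.

End Products.

(** * The product formula in terms of exponents of the generating character *)

Section Mult.
Variables (F : finFieldType) (theta t : F -> algC) (g : F).
Hypothesis theta_char : addchar theta.
Hypothesis t_char : mulchar t.
Hypothesis g_prim : (#|F| - 1).-primitive_root g.
Hypothesis tg_prim : (#|F| - 1).-primitive_root (t g).

Local Notation Q := (#|F| - 1)%N.
Local Notation q := #|F|.
Local Notation X := (cpow t).
Local Notation G := (gauss_pow theta t).
Local Notation J := (jacobi_pow t).

Lemma cpow_prim (n u : nat) y : (n * u)%N = Q -> Q.-primitive_root y ->
  n.-primitive_root (X u%:Z y).
Proof.
move=> nu yp; have Q0 := prim_order_gt0 g_prim.
have y0 : y != 0 := prim_root_neq0 yp.
have [i yi] := nonzero_log g_prim y0.
have ty : Q.-primitive_root (t y).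
  by rewrite yi (mulcharX t_char) (prim_root_exp_coprime _ tg_prim) -(prim_root_exp_coprime _ g_prim) -yi.
rewrite /cpow (negPf y0) -exprnP; have := exp_prim_root ty u.
have u0 : (0 < u)%N by move: Q0; rewrite -nu muln_gt0 => /andP[].
by rewrite -nu (gcdn_idPl (dvdn_mull _ (dvdnn u))) mulnK.
Qed.

Lemma G_mult (n u : nat) k : (n * u)%N = Q ->
  \prod_(j < n) G (k + u%:Z *+ j) =
  \prod_(1 <= j < n) G (u%:Z *+ j) * (X (k *+ n) n%:R)^-1 * G (k *+ n).
Proof.
move=> nu; have Q0 := prim_order_gt0 g_prim.
have n0 : (0 < n)%N by move: Q0; rewrite -nu muln_gt0 => /andP[].
have nF : n%:R != 0 :> F by apply: natr_dvd_neq0; rewrite -nu dvdn_mulr.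
have [C HD] := Hasse_Davenport_product n0 theta_char (cpow_mulchar t_char u%:Z)
  (fun y => @cpow_prim n u y nu).
have {}HD l : \prod_(j < n) G (l + u%:Z *+ j) = C * (X (l *+ n) n%:R)^-1 * G (l *+ n).
  rewrite (cpowMn t_char) //; have -> : G (l *+ n) = gauss theta (fun x => X l x ^+ n).
    by apply: eq_bigr => x _; rewrite (cpowMn t_char).
  rewrite -(HD _ (cpow_mulchar t_char l)).
  apply: eq_bigr => -[j jn] _ /=; apply: eq_bigr => x _; congr (_ * _).
  case: j {jn} => [|j]; first by rewrite mulr0n addr0 mulr1.
  by rewrite (cpowD t_char) (cpowMn t_char).
(* At [l = 0] the trivial character contributes the Gauss sum [-1] on both sides, leaving the
   constant as the product over [1 <= j < n]. *)
have CE : C = \prod_(1 <= j < n) G (u%:Z *+ j).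
  have := HD 0; rewrite mul0rn (G_eps theta_char t_char g_prim tg_prim) ?dvdz0 //.
  rewrite (cpow_eps t_char g_prim tg_prim) ?dvdz0 // nF invr1 mulr1 mulrN1.
  case: n n0 {nu nF HD} => // n _; rewrite big_ord_recl mulr0n addr0.
  rewrite (G_eps theta_char t_char g_prim tg_prim) ?dvdz0 // mulN1r => /oppr_inj <-.
  rewrite big_add1 /= big_mkord; apply: eq_bigr => j _; by rewrite add0r.
by rewrite HD CE.
Qed.

End Mult.

(** * Fourier coefficients of the two sides *)

Section Coefficients.
Variables (F : finFieldType) (theta t : F -> algC) (g : F) (r c : nat).
Hypothesis theta_char : addchar theta.
Hypothesis t_char : mulchar t.
Hypothesis g_prim : (#|F| - 1).-primitive_root g.
Hypothesis tg_prim : (#|F| - 1).-primitive_root (t g).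
Hypothesis QE : (#|F| - 1 = 2 * (2 * r + 2) * (2 * r + 1) * c)%N.

Local Notation Q := (#|F| - 1)%N.
Local Notation q := #|F|.
Local Notation X := (cpow t).
Local Notation G := (gauss_pow theta t).
Local Notation J := (jacobi_pow t).
Local Notation e := (2 * r + 1)%N.
Local Notation d := (2 * r + 2)%N.

Let c_gt0 : (0 < c)%N.
Proof. by move: (prim_order_gt0 g_prim); rewrite QE muln_gt0 => /andP[]. Qed.

(** Half of [Q], so this exponent gives the quadratic character [phi]. *)
Definition half_order : nat := (d * e * c)%N.
Local Notation h := (half_order%:Z).

Lemma half_orderD : (half_order + half_order)%N = Q. Proof. by rewrite QE /half_order; clear; lia. Qed.

Let QZ : Q%:Z = 2 * h. Proof. by rewrite -half_orderD; lia. Qed.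

Let Gmod := G_mod theta t_char g_prim tg_prim.
Let Xmod := cpow_mod t_char g_prim tg_prim.
Let XN1 := cpow_evenN1 t_char.
Let Gconj := G_conj theta_char t_char g_prim tg_prim.
Let Gneq0 := G_neq0 theta_char t_char g_prim tg_prim.
Let Geps := G_eps theta_char t_char g_prim tg_prim.
Let Gmul := G_mul theta_char t_char g_prim tg_prim.
Let qn0 : q%:R != 0 :> algC := card_natr_neq0 F.

(** [half_order] is even because [d] is. *)
Lemma X_half_N1 : X h (-1) = 1.
Proof.
have -> : h = ((r + 1) * e * c)%N%:Z + ((r + 1) * e * c)%N%:Z by rewrite /half_order; clear; lia.
exact: XN1.
Qed.

Lemma half_ndvd : ~~ (Q %| h)%Z.
Proof.
have h0 : (0 < half_order)%N by have := prim_order_gt0 g_prim; rewrite -half_orderD addn_gt0 orbb.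
by rewrite dvdzE /= -half_orderD; apply/negP => /(dvdn_leq h0); lia.
Qed.

Lemma G_half_sqr : G h * G (- h) = q%:R.
Proof. by rewrite Gconj ?half_ndvd // X_half_N1 mul1r. Qed.

(** The first Jacobi sum comes from summing over [b], the second from summing over [x]; the last
    term records the one nonzero [x] with [x^d + a x^(d-1) = 0]. *)
Definition jacobi_coef k := J (- k) h * J (h - k *+ e) (h - k)
  + (if (Q %| h - k)%Z then Q%:R else 0).

Let dvdQ x y : x = Q%:Z * y -> (Q %| x)%Z.
Proof. by move=> ->; apply: dvdz_mulr. Qed.

(** Generically each Jacobi sum is a quotient of Gauss sums. When [Q] divides [h - k] or [k *+ d],
    the corrections in [G_mul] and the extra term of [jacobi_coef] conspire to keep the same
    formula. *)
Lemma jacobi_coefE k :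
  q%:R * jacobi_coef k = G h * G (- k) * G (k *+ d) * G (h - k *+ e).
Proof.
rewrite /jacobi_coef.
have GN : G h * G (- h) = q%:R := G_half_sqr.
have Qq : Q%:R = q%:R - 1 :> algC by rewrite natrB // ltnW // card_finField_gt1.
have E1 := Gmul (- k) h; have E2 := Gmul (h - k *+ e) (h - k).
rewrite [- k + h]addrC in E1.
have dvd2 : (Q %| h - k *+ e + (h - k))%Z = (Q %| k *+ d)%Z.
  have -> : h - k *+ e + (h - k) = - (k *+ d) + Q%:Z * 1 by rewrite QZ; ring.
  by rewrite rpredDr ?dvdz_mulr // rpredN.
have G2 : G (h - k *+ e + (h - k)) = G (- (k *+ d)).
  by apply: Gmod; apply: (@dvdQ _ 1); rewrite QZ; ring.
rewrite G2 dvd2 in E2.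
(* If [k] is [h] modulo [Q], the Jacobi sums are [-1] and [Q - 1], and the extra [Q] brings the
   coefficient to 1. *)
case: ifP E1 => [Qhk|Qhk] E1.
  have /dvdzP[y yE] := Qhk; rewrite QZ in yE.
  have kE : k = h - y * (2 * h) by rewrite -yE; ring.
  have Qkd : (Q %| k *+ d)%Z by apply: (@dvdQ _ (r.+1%:Z - y * d%:Z)); rewrite QZ kE; lia.
  have Qke : (Q %| h - k *+ e)%Z by apply: (@dvdQ _ (- r%:Z + y * e%:Z)); rewrite QZ kE; lia.
  have Gk : G (- k) = G (- h) by apply: Gmod; apply: (@dvdQ _ y); rewrite QZ kE; ring.
  have Xhk : X (h - k) (-1) = 1.
    by rewrite (cpow_eps t_char g_prim tg_prim) // oppr_eq0 oner_eq0.
  have G0 : G (- (k *+ d)) = -1 by rewrite Geps ?rpredN.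
  rewrite Qkd Xhk G0 (Geps Qke) (Geps Qhk) in E2.
  rewrite X_half_N1 (Geps Qhk) Gk [G _ * G _]mulrC GN in E1.
  rewrite (Geps Qkd) (Geps Qke) Gk GN.
  have -> : J (- k) h = Q%:R - q%:R by rewrite E1; ring.
  have -> : J (h - k *+ e) (h - k) = 1 * Q%:R - (- 1 * - 1) by rewrite E2; ring.
  rewrite Qq; ring.
rewrite addr0 in E1 *.
have -> : J (- k) h = G (- k) * G h / G (h - k) by rewrite E1 mulfK.
(* If only [k *+ d] is a multiple of [Q], the two characters in the second Jacobi sum are inverse to
   each other, so that sum is [- X (h - k) (-1)]. *)
have [Qkd|Qkd] := boolP (Q %| k *+ d)%Z.
  rewrite Qkd in E2.
  have Gc : G (h - k) * G (- (h - k)) = X (h - k) (-1) * q%:R by apply: Gconj; rewrite Qhk.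
  have Ge : G (h - k *+ e) = G (- (h - k)).
    apply: Gmod; rewrite (_ : _ - _ = h - k *+ e + (h - k)); last by ring.
    by rewrite dvd2.
  rewrite Ge in E2 *.
  rewrite [G _ * _]mulrC Gc (Geps (k := - _)) ?rpredN // Qq in E2.
  have -> : J (h - k *+ e) (h - k)
      = X (h - k) (-1) * (q%:R - 1) - X (h - k) (-1) * q%:R by rewrite E2; ring.
  rewrite (Geps Qkd).
  transitivity (- (G (- k) * G h) * (X (h - k) (-1) * q%:R) / G (h - k)); first by ring.
  by rewrite -Gc; field.
rewrite (negPf Qkd) addr0 in E2.
have -> : J (h - k *+ e) (h - k) = G (h - k *+ e) * G (h - k) / G (- (k *+ d)) by rewrite E2 mulfK.
have Gc : G (k *+ d) * G (- (k *+ d)) = q%:R.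
  rewrite Gconj // (_ : k *+ d = k *+ r.+1 + k *+ r.+1) ?XN1 ?mul1r //.
  by rewrite -mulrnDr; congr (_ *+ _); lia.
by rewrite addr0 -Gc; field; rewrite !Gneq0.
Qed.

Local Notation u := ((2 * e * c)%N%:Z).
Local Notation v := ((d * c)%N%:Z).

Definition jacobi_binom a b := X b (-1) / q%:R * J a (- b).

(** [u = Q / d] and [v = Q / (2 (d - 1))] are the exponents of [chi] and [psi]. The omitted index
    [r.+1] is [d / 2], where both [u *+ j] and [v *+ (2 * j - 1)] equal [h]. *)
Definition hyper_coef k :=
  jacobi_binom (h + k) k * (jacobi_binom k (h + k) *
    \prod_(j <- iota 1 e | j != r.+1)
       jacobi_binom (u *+ j + k) (v *+ (2 * j - 1) + k)).

(** Since [b] and [k] differ by an even number, the sign is that of [k]; over the [d] binomials of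
    [hyper_coef] these signs multiply to 1. *)
Lemma jacobi_binomE a b b' k : b = b' + b' + k -> ~~ (Q %| a - b)%Z ->
  jacobi_binom a b = X k (-1) / q%:R * (G a * G (- b) / G (a - b)).
Proof.
move=> bE ab; rewrite /jacobi_binom (J_G theta_char t_char g_prim tg_prim) //.
by congr (_ / _ * _); rewrite bE (cpowD t_char) XN1 mul1r.
Qed.

Lemma G_pair z : ~~ (Q %| z + z)%Z -> G (z + z) * G (- (z + z)) = q%:R.
Proof. by move=> Qz; rewrite Gconj // XN1 mul1r. Qed.

Lemma small_ndvd z : (0 < `|z| < Q)%N -> ~~ (Q %| z)%Z.
Proof. by move=> /andP[z0 zQ]; rewrite dvdzE; apply/negP => /(dvdn_leq z0); lia. Qed.

(** The indices [j] and [d - j] give opposite exponents modulo [Q], hence a factor [q] per pair; the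
    middle index gives [G h]. *)
Lemma prod_G_u : \prod_(1 <= j < d) G (u *+ j) = G h * q%:R ^+ r.
Proof.
rewrite -prod_iota_middle prod_pairs_middle; congr (G _ * _); first by rewrite /half_order; lia.
rewrite (eq_big_nat _ _ (F2 := fun=> q%:R)) => [|j jr].
  by rewrite prodr_const_nat subn1.
pose z : int := (e * c * j)%N.
have zE : u *+ j = z + z by rewrite /z; lia.
have -> : G (u *+ (2 * r + 2 - j)) = G (- (z + z)).
  by apply: Gmod; apply: (@dvdQ _ 1); rewrite QE /z; lia.
rewrite zE G_pair // small_ndvd // QE /z; nia.
Qed.

Lemma prod_G_v : \prod_(1 <= j < e) G ((v + v) *+ j) = q%:R ^+ r.
Proof.
rewrite prod_pairs_odd (eq_big_nat _ _ (F2 := fun=> q%:R)) => [|j jr].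
  by rewrite prodr_const_nat subn1.
pose z : int := (d * c * j)%N.
have zE : (v + v) *+ j = z + z by rewrite /z; lia.
have -> : G ((v + v) *+ (2 * r + 1 - j)) = G (- (z + z)).
  by apply: Gmod; apply: (@dvdQ _ 1); rewrite QE /z; lia.
rewrite zE G_pair // small_ndvd // QE /z; nia.
Qed.

(** The numerators complete two full progressions: [G (h + k)] and [G k] supply the missing top
    terms [j = d / 2] and [j = 0], and [G (- (h + k))] the missing bottom term. The product formula
    collapses both, [G (- k)] is left over, and the denominators pair off to powers of [q]. *)
Lemma hyper_coefE k : q%:R ^+ (r + 3) * hyper_coef k =
  G h * (X (k *+ d) d%:R)^-1 * (X h e%:R * X (k *+ e) e%:R)
    * G (k *+ d) * G (- k) * G (h - k *+ e).
Proof.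
(* Half the top exponent minus the bottom one: [u j - v (2 j - 1) = 2 c (d / 2 - j)], which vanishes
   only at the omitted index. *)
pose w (j : nat) : int := c%:Z * (r.+1%:Z - j%:Z).
have wE j : (1 <= j)%N -> u *+ j + k - (v *+ (2 * j - 1) + k) = w j + w j.
  by case: j => // j _; rewrite /w (_ : (2 * j.+1 - 1 = 2 * j + 1)%N); lia.
have w_ndvd j : j \in iota 1 e -> j != r.+1 -> ~~ (Q %| w j + w j)%Z.
  rewrite mem_iota => jr jn; apply: small_ndvd.
  have -> : w j + w j = (2 * c)%N%:Z * (r.+1%:Z - j%:Z) by rewrite /w; lia.
  rewrite abszM absz_nat.
  have : (0 < `|r.+1%:Z - j%:Z| <= 2 * r)%N by lia.
  by rewrite QE; nia.
have P1 : G (h + k) * (G k * \prod_(j <- iota 1 e | j != r.+1) G (u *+ j + k))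
    = G h * q%:R ^+ r * (X (k *+ d) d%:R)^-1 * G (k *+ d).
  rewrite -prod_G_u -(G_mult theta_char t_char g_prim tg_prim); last by rewrite QE; lia.
  have d0 : (0 < d)%N by lia.
  rewrite -(big_mkord xpredT (fun j => G (k + u *+ j))) (big_ltn d0) mulr0n addr0 mulrCA.
  congr (_ * _).
  rewrite -prod_iota_middle; congr (_ * _); last by apply: eq_bigr => j _; rewrite addrC.
  by congr G; rewrite addrC; congr (_ + _); rewrite /half_order; lia.
(* [k0] is the bottom exponent at [j = e]; decreasing [j] steps through a progression of difference
   [v + v = Q / e]. Since [v * e = h], [k0 *+ e] is [h - k *+ e] modulo [Q]. *)
pose k0 := - (v *+ (4 * r + 1) + k).
have k0E : (Q %| k0 *+ e - (h - k *+ e))%Z.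
  apply: (@dvdQ _ (- e%:Z)); by rewrite QE /k0 /half_order; lia.
have P2 : G (- (h + k)) * \prod_(j <- iota 1 e | j != r.+1) G (- (v *+ (2 * j - 1) + k))
    = q%:R ^+ r * (X h e%:R * X (k *+ e) e%:R) * G (h - k *+ e).
  rewrite -(Gmod k0E).
  have -> : X h e%:R * X (k *+ e) e%:R = (X (k0 *+ e) e%:R)^-1.
    rewrite (Xmod _ k0E) -cpowN -cpowD //; apply: Xmod; apply: (@dvdQ _ 1); rewrite QZ; ring.
  rewrite -prod_G_v -(G_mult theta_char t_char g_prim tg_prim) // ?QE; last by lia.
  have -> : - (h + k) = - (v *+ (2 * r.+1 - 1) + k) 
    by rewrite /half_order (_ : (2 * r.+1 - 1 = 2 * r + 1)%N); lia.
  rewrite (prod_iota_middle (fun j => G (- (v *+ (2 * j - 1) + k)))) prod_rev_iota.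
  apply: eq_bigr => i _; congr G; rewrite /k0; have ie := ltn_ord i.
  by rewrite (_ : (2 * (2 * r + 1 - i) - 1 = 4 * r + 1 - 2 * i)%N); lia.
(* The denominators at [j] and [d - j] have opposite even exponents, so each pair gives [q]. *)
have P3 : \prod_(j <- iota 1 e | j != r.+1) G (w j + w j) = q%:R ^+ r.
  rewrite prod_pairs_middle (eq_big_nat _ _ (F2 := fun=> q%:R)) => [|j jr].
    by rewrite prodr_const_nat subn1.
  have -> : w (2 * r + 2 - j)%N = - w j by rewrite /w; lia.
  rewrite -opprD G_pair // w_ndvd ?mem_iota //; lia.
rewrite /hyper_coef.
have hE : h + k = ((r + 1) * e * c)%N%:Z + ((r + 1) * e * c)%N%:Z + k.
  by congr (_ + _); rewrite /half_order; lia.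
rewrite (@jacobi_binomE (h + k) k 0 k) ?add0r ?addrK ?half_ndvd //.
rewrite (jacobi_binomE hE); last first.
  by rewrite opprD addrCA subrr addr0 rpredN half_ndvd.
have -> : k - (h + k) = - h by ring.
pose b' (j : nat) := ((r + 1) * c)%N%:Z *+ (2 * j - 1).
rewrite big_seq_cond (eq_bigr (fun j => X k (-1) / q%:R *
   (G (u *+ j + k) * G (- (v *+ (2 * j - 1) + k)) / G (w j + w j)))); last first.
  move=> j /andP[jm jr]; have j1 : (0 < j)%N by move: jm; rewrite mem_iota => /andP[].
  rewrite -(wE _ j1) (@jacobi_binomE _ _ (b' j) k) // ?wE ?w_ndvd //.
  by rewrite /b' -mulrnDl; congr (_ *+ _ + _); lia.
rewrite -big_seq_cond !big_split /= !prodfV P3.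
have constE (x : algC) : \prod_(i <- iota 1 e | i != r.+1) x = (x * x) ^+ r.
  by rewrite prod_pairs_middle prodr_const_nat subn1.
have xx : X k (-1) * X k (-1) = 1 by rewrite -expr2 (cpowN1_sqr t_char).
rewrite !constE xx expr1n mul1r exprMn exprD.
move: P1 P2 (expf_neq0 r qn0) (Gneq0 h) (Gneq0 (- h)) G_half_sqr qn0.
move: ((X (k *+ d) d%:R)^-1) (bigop _ _ _) (bigop _ _ _) => Xd p2 p1.
move: (q%:R : algC) (q%:R ^+ r) (X k (-1)) xx (G h) (G (- h)) => qq y x xx gh gh' P1 P2 y0 gh0 gh0' gq q0.
transitivity ((G (h + k) * (G k * p1)) * (G (- (h + k)) * p2) * G (- k) * (x * x)
  * (qq / (gh * gh')) / (y * y)); first by field; rewrite ?gh0 ?gh0' ?y0 ?q0.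
by rewrite P1 P2 xx gq; field; rewrite ?gh0 ?gh0' ?y0 ?q0.
Qed.

End Coefficients.

Lemma sum_sqrt_phiq (F : finFieldType) (x : F) : 2%:R != 0 :> F ->
  \sum_(y : F) (y ^+ 2 == x)%:R = 1 + phiq x.
Proof.
move=> F2; rewrite /phiq; have [->|x0] := eqVneq x 0.
  rewrite addr0 (bigD1 0) //= expr0n eqxx big1 ?addr0 // => y y0.
  by rewrite sqrf_eq0 (negPf y0).
case: existsP => [[z /eqP zx]|nsq]; last first.
  by rewrite subrr big1 // => y _; case: eqP => // yx; case: nsq; exists y; apply/eqP.
have z0 : z != 0 by apply: contraNneq x0 => z0; rewrite -zx z0 expr0n.
have zz : - z != z.
  by rewrite -subr_eq0 -opprD oppr_eq0 -mulr2n -mulr_natl mulf_neq0.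
rewrite (bigD1 z) //= zx eqxx (bigD1 (- z)) //= sqrrN zx eqxx big1 ?addr0 //.
move=> y /andP[yz yNz]; rewrite -zx eqf_sqr.
by rewrite (negPf yz) (negPf yNz).
Qed.

(** * Fourier expansion of the curve's character sum in [b] *)

Section Fourier.
Variables (F : finFieldType) (theta t : F -> algC) (g : F) (r c : nat).
Hypothesis theta_char : addchar theta.
Hypothesis t_char : mulchar t.
Hypothesis g_prim : (#|F| - 1).-primitive_root g.
Hypothesis tg_prim : (#|F| - 1).-primitive_root (t g).
Hypothesis QE : (#|F| - 1 = 2 * (2 * r + 2) * (2 * r + 1) * c)%N.

Local Notation Q := (#|F| - 1)%N.
Local Notation q := #|F|.
Local Notation X := (cpow t).
Local Notation J := (jacobi_pow t).
Local Notation e := (2 * r + 1)%N.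
Local Notation d := (2 * r + 2)%N.
Local Notation h := ((half_order r c)%:Z).

Let XM k := mulcharM (cpow_mulchar t_char k).
Let XD := cpowD t_char.
Let Xmod := cpow_mod t_char g_prim tg_prim.

Lemma fourier_inversion (W : F -> algC) b : b != 0 ->
  Q%:R * W b = \sum_(k < Q) X k%:Z b * \sum_y X (- k%:Z) y * W y.
Proof.
move=> b0; under eq_bigr => k _ do rewrite mulr_sumr.
rewrite exchange_big (bigD1 b) //= [X in _ + X]big1 ?addr0.
  under eq_bigr => k _ do rewrite mulrA -XD subrr.
  rewrite -mulr_suml; congr (_ * _).
  under eq_bigr => k _ do rewrite (cpow_eps t_char g_prim tg_prim) ?dvdz0 // b0.
  by rewrite sumr_const card_ord.
move=> y yb; have [->|y0] := eqVneq y 0.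
  by rewrite big1 // => k _; rewrite cpow0 mul0r mulr0.
transitivity ((\sum_(k < Q) X k%:Z (b / y)) * W y).
  rewrite mulr_suml; apply: eq_bigr => k _.
  rewrite mulrA cpowN XM -[X k%:Z y^-1](mulKf (cpow_neq0 t_char k%:Z y0)) -XM mulfV //.
  by rewrite (mulchar1 (cpow_mulchar t_char _)) mulr1.
rewrite (sum_cpow_nat t_char g_prim tg_prim).
have -> : (b / y == 1) = false.
  by apply/negbTE; apply: contra yb => /eqP by1; rewrite -(divfK y0 b) by1 mul1r.
by rewrite !mul0r.
Qed.

Lemma cpow_oppN1 k : X (- k) (-1) = X k (-1).
Proof.
have x0 : X k (-1) != 0 by rewrite cpow_neq0 // oppr_eq0 oner_eq0.
by apply: (mulfI x0); rewrite cpowN mulfV // -expr2 (cpowN1_sqr t_char).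
Qed.

Let QZ : Q%:Z = 2 * h. Proof. by rewrite -(half_orderD QE); lia. Qed.

Let dvdQ x y : x = Q%:Z * y -> (Q %| x)%Z.
Proof. by move=> ->; apply: dvdz_mulr. Qed.

(** For fixed [x], put [z = x^(d-1) (x + a)]: scaling [y] by [- z] makes the inner sum a Jacobi sum,
    and then scaling [x] by [- a] makes the outer sum one. The value [z = 0], reached for [x != 0]
    only at [x = - a], is treated apart. *)
Lemma curve_fourier_coef a k : a != 0 ->
  \sum_y X (- k) y * (\sum_(x | x != 0) X h (x ^+ d + a * x ^+ e + y))
  = X (- (k *+ d)) a * jacobi_coef t r c k.
Proof.
move=> a0; under eq_bigr => y _ do rewrite mulr_sumr.
rewrite exchange_big /=.
have inner (z : F) : \sum_y X (- k) y * X h (z + y) =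
    X (h - k) z * X k (-1) * J (- k) h + (z == 0)%:R * (if (Q %| h - k)%Z then Q%:R else 0).
  have [->|z0] := eqVneq z 0.
    rewrite cpow0 !mul0r add0r mul1r -(cpow_sum t_char g_prim tg_prim).
    by apply: eq_bigr => y _; rewrite add0r XD mulrC.
  rewrite mul0r addr0; have Nz0 : - z != 0 by rewrite oppr_eq0.
  rewrite (reindex_inj (mulfI Nz0)) mulr_sumr; apply: eq_bigr => y _ /=.
  have -> : z + - z * y = z * (1 - y) by ring.
  rewrite -[- z]mulN1r !XM XD.
  rewrite cpow_oppN1.
  ring.
under eq_bigr => x _ do rewrite inner.
rewrite big_split /= -!mulr_suml.
have factor x : x ^+ d + a * x ^+ e = x ^+ e * (x + a) by rewrite addn2 addn1 !exprS; ring.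
pose l := h - k.
have Ne : X (l *+ e) (-1) = X k (-1).
  have -> : l *+ e = l *+ r + l *+ r + l by rewrite /l; ring.
  by rewrite XD (cpow_evenN1 t_char) mul1r /l XD (X_half_N1 _ _ t_char) mul1r cpow_oppN1.
have Xsum : \sum_(x | x != 0) X l (x ^+ d + a * x ^+ e) =
    X (- (k *+ d)) a * X k (-1) * J (h - k *+ e) l.
  have e0 : (0 < e)%N by lia.
  transitivity (\sum_x X l (x ^+ e * (x + a))).
    rewrite [RHS](bigD1 0) //= expr0n gtn_eqF // mul0r cpow0 add0r.
    by apply: eq_bigr => x _; rewrite factor.
  have Na0 : - a != 0 by rewrite oppr_eq0.
  rewrite (reindex_inj (mulfI Na0)) mulr_sumr; apply: eq_bigr => y _ /=.
  have -> : - a * y + a = a * (1 - y) by ring.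
  rewrite XM (mulcharX (cpow_mulchar t_char l)) // -cpowMn // -[- a]mulN1r !XM Ne.
  (* [h *+ e] is [h] modulo [Q] because [e] is odd. *)
  have -> : X (h - k *+ e) y = X (l *+ e) y.
    by apply: Xmod; apply: (@dvdQ _ (- r%:Z)); rewrite QZ /l; ring.
  have -> : X (- (k *+ d)) a = X (l *+ e) a * X l a.
    rewrite -XD; apply: Xmod; apply: (@dvdQ _ (- r%:Z - 1)); rewrite QZ /l; ring.
  ring.
have one : \sum_(x : F | x != 0) (x ^+ d + a * x ^+ e == 0)%:R = 1 :> algC.
  rewrite (bigD1 (- a)) ?oppr_eq0 //= factor addNr mulr0 eqxx big1 ?addr0 // => x /andP[x0 xa].
  by rewrite factor mulf_eq0 expf_eq0 (negPf x0) andbF /= addr_eq0 (negPf xa).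
rewrite Xsum one mul1r /jacobi_coef mulrDr; congr (_ + _).
  have := cpowN1_sqr t_char k; rewrite expr2 => kk.
  rewrite -/l; transitivity (X (- (k *+ d)) a * (X k (-1) * X k (-1))
    * (J (- k) h * J (h - k *+ e) l)); first by ring.
  by rewrite kk mulr1.
(* If [k] is [h] modulo [Q], then [k *+ d] is a multiple of [Q] because [d] is even, so the factor
   at [a] is 1. *)
case: ifP => Qhk; last by rewrite mulr0.
rewrite (cpow_eps t_char g_prim tg_prim) ?a0 ?mul1r //.
have /dvdzP[y yE] := Qhk; rewrite QZ in yE.
have kE : k = h - y * (2 * h) by rewrite -yE; ring.
by apply: (@dvdQ _ (- r.+1%:Z + y * d%:Z)); rewrite QZ kE; lia.
Qed.

End Fourier.

(** * Characters of the unit group *)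

Section Mch.
Variable (F : finFieldType).

Lemma mch_unit (xi : 'CF(UG F)) (u : {unit F}) : mch xi (val u) = xi u.
Proof. by rewrite /mch valK. Qed.

Lemma unit_of_neq0 (x : F) : x != 0 -> exists u : {unit F}, x = val u.
Proof. by rewrite -unitfE => xU; exists (FinRing.Unit xU). Qed.

Lemma mch0 (xi : 'CF(UG F)) : mch xi 0 = 0.
Proof. by rewrite /mch insubN // unitr0. Qed.

Lemma mch_mulchar (xi : 'CF(UG F)) : xi \is a linear_char -> mulchar (mch xi).
Proof.
move=> lin; split; first exact: mch0.
  by rewrite -[1]/(val (1%g : {unit F})) mch_unit lin_char1.
move=> x y; have [->|x0] := eqVneq x 0; first by rewrite mul0r mch0 mul0r.
have [->|y0] := eqVneq y 0; first by rewrite mulr0 mch0 mulr0.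
have [[u ->] [v ->]] := (unit_of_neq0 x0, unit_of_neq0 y0).
by rewrite -FinRing.val_unitM !mch_unit lin_charM ?inE.
Qed.

Lemma mch_exp (xi : 'CF(UG F)) k : mch (xi ^+ k) =1 cpow (mch xi) k%:Z.
Proof.
move=> x; rewrite /cpow; case: eqVneq => [->|x0]; first exact: mch0.
by have [u ->] := unit_of_neq0 x0; rewrite !mch_unit exp_cfunE ?inE.
Qed.

Lemma mch_inj (xi zeta : 'CF(UG F)) : mch xi =1 mch zeta -> xi = zeta.
Proof. by move=> E; apply/cfunP => u; rewrite -!mch_unit E. Qed.

Lemma card_Iirr_UG : #|Iirr (UG F)| = (#|F| - 1)%N.
Proof.
rewrite card_Iirr_abelian ?card_finField_unit ?subn1 //.
by have := cyclic_abelian (field_unit_group_cyclic (UG F)).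
Qed.

Variable T : 'CF(UG F).
Hypothesis linT : T \is a linear_char.
Hypothesis genT : forall xi : 'CF(UG F), xi \is a linear_char -> exists k : nat, xi = T ^+ k.

(** If the value at [g] had order [n], then [T ^+ n = 1], and the powers of [T] would give at most
    [n] of the [q - 1] linear characters. *)
Lemma mch_gen_prim g : (#|F| - 1).-primitive_root g -> (#|F| - 1).-primitive_root (mch T g).
Proof.
move=> gp; have Q0 := prim_order_gt0 gp; have tM := mch_mulchar linT.
have tX x n : mch T (x ^+ n) = mch T x ^+ n by apply: mulcharX.
have wQ : mch T g ^+ (#|F| - 1) = 1 by rewrite -tX (prim_expr_order gp) (mulchar1 tM).
have [n np nQ] := prim_order_exists Q0 wQ.
suff <- : n = (#|F| - 1)%N by [].
apply/eqP; rewrite eqn_leq dvdn_leq //=.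
have n0 := prim_order_gt0 np.
have Tn : T ^+ n = 1.
  apply: mch_inj => x; have [->|x0] := eqVneq x 0; first by rewrite !mch0.
  rewrite mch_exp /cpow (negPf x0) -exprnP.
  have [i ->] := nonzero_log gp x0; rewrite tX exprAC (prim_expr_order np) expr1n.
  have [u ->] := unit_of_neq0 (expf_neq0 i (prim_root_neq0 gp)).
  by rewrite mch_unit cfun1E inE.
pose f (k : 'I_n) : Iirr (UG F) := cfIirr (T ^+ k).
have fsurj i : i \in codom f.
  have lini : 'chi_i \is a linear_char.
    apply/char_abelianP; exact: (cyclic_abelian (field_unit_group_cyclic (UG F))).
  have [k kE] := genT lini.
  have kn : (k %% n < n)%N by rewrite ltn_mod.
  apply/codomP; exists (Ordinal kn); apply: irr_inj.
  rewrite cfIirrE /= ?lin_char_irr ?rpredX //.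
  by rewrite kE [in LHS](divn_eq k n) exprD mulnC exprM Tn expr1n mul1r.
rewrite -card_Iirr_UG -[n in (_ <= n)%N]card_ord.
have -> : #|Iirr (UG F)| = #|codom f| by apply: eq_card => i; rewrite fsurj.
exact: leq_image_card.
Qed.

(** The powers of [T] below [q - 1] differ already at [g], so by counting they exhaust the
    irreducible characters. *)
Lemma sum_Iirr_mch (g : F) (E : (F -> algC) -> algC) : (#|F| - 1).-primitive_root g ->
  (forall A B, A =1 B -> E A = E B) ->
  \sum_(i : Iirr (UG F)) E (mch 'chi_i) = \sum_(k < #|F| - 1) E (cpow (mch T) k%:Z).
Proof.
move=> gp Eext; have wp := mch_gen_prim gp.
pose f (k : 'I_(#|F| - 1)) : Iirr (UG F) := cfIirr (T ^+ k).
have fE k : 'chi_(f k) = T ^+ k by rewrite cfIirrE // lin_char_irr // rpredX.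
have finj : injective f.
  move=> k l kl; have : T ^+ k = T ^+ l by rewrite -!fE kl.
  move=> /(congr1 (fun xi => mch xi g)); rewrite !mch_exp /cpow (negPf (prim_root_neq0 gp)).
  move/eqP; rewrite -!exprnP (eq_prim_root_expr wp) !modn_small // => /eqP; exact: val_inj.
have [f' fK f'K] := inj_card_bij finj (eq_leq (etrans card_Iirr_UG (esym (card_ord _)))).
rewrite (reindex f); last by exists f' => i _.
by apply: eq_bigr => k _; apply: Eext => x; rewrite fE mch_exp.
Qed.

End Mch.

(** * Termwise comparison of the two Fourier expansions *)

Section Comparison.
Variables (F : finFieldType) (theta t : F -> algC) (g : F) (r c : nat).
Hypothesis theta_char : addchar theta.
Hypothesis t_char : mulchar t.
Hypothesis g_prim : (#|F| - 1).-primitive_root g.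
Hypothesis tg_prim : (#|F| - 1).-primitive_root (t g).
Hypothesis QE : (#|F| - 1 = 2 * (2 * r + 2) * (2 * r + 1) * c)%N.

Local Notation Q := (#|F| - 1)%N.
Local Notation q := #|F|.
Local Notation X := (cpow t).
Local Notation e := (2 * r + 1)%N.
Local Notation d := (2 * r + 2)%N.
Local Notation h := ((half_order r c)%:Z).

Lemma degree_neq0 : d%:R != 0 :> F.
Proof. by apply: natr_dvd_neq0; rewrite QE -mulnA dvdn_mulr // dvdn_mull. Qed.

Lemma pred_degree_neq0 : e%:R != 0 :> F.
Proof. by apply: natr_dvd_neq0; rewrite QE dvdn_mulr // dvdn_mull. Qed.

Lemma cpow_inv k x : X k x^-1 = (X k x)^-1.
Proof.
have [->|x0] := eqVneq x 0; first by rewrite invr0 cpow0 invr0.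
apply: (mulfI (cpow_neq0 t_char k x0)); rewrite -(mulcharM (cpow_mulchar t_char k)).
by rewrite mulfV ?(mulchar1 (cpow_mulchar t_char k)) ?mulfV ?cpow_neq0.
Qed.

(** The powers of [d] and [d - 1] in [beta] exactly cancel the factors left by the two uses of the
    product formula, and [phi (d - 1)] occurs squared. *)
Lemma hyper_jacobi k a b : a != 0 ->
  q%:R ^+ r.+1 * X h e%:R * (q%:R * hyper_coef t r c k)
     * X k (b * d%:R ^+ d / (a ^+ d * e%:R ^+ e))
  = X k b * (X (- (k *+ d)) a * jacobi_coef t r c k).
Proof.
move=> a0.
have := hyper_coefE theta_char t_char g_prim tg_prim QE k.
have jE := jacobi_coefE theta_char t_char g_prim tg_prim QE k.
have qn0 : q%:R != 0 :> algC := card_natr_neq0 F.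
have XM l := mulcharM (cpow_mulchar t_char l).
have d0 : (0 < d)%N by lia.
have e0 : (0 < e)%N by lia.
have XX l n x : (0 < n)%N -> X l (x ^+ n) = X (l *+ n) x.
  by move=> n0; rewrite (mulcharX (cpow_mulchar t_char l)) // -cpowMn.
rewrite !XM cpow_inv XM !XX // cpowN.
have h2 : X h e%:R * X h e%:R = 1.
  rewrite -cpowD // (cpow_eps t_char g_prim tg_prim) ?pred_degree_neq0 //.
  by rewrite -PoszD (half_orderD QE).
have Xd0 := cpow_neq0 t_char (k *+ d) degree_neq0.
have Xe0 := cpow_neq0 t_char (k *+ e) pred_degree_neq0.
have Xa0 := cpow_neq0 t_char (k *+ d) a0.
move=> HE.
have {HE jE} : q%:R ^+ (r + 3) * hyper_coef t r c k
   = (X (k *+ d) d%:R)^-1 * (X h e%:R * X (k *+ e) e%:R) * (q%:R * jacobi_coef t r c k).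
  by rewrite HE jE; move: (_^-1) => i; ring.
rewrite (_ : r + 3 = r.+1 + 2)%N; last by lia.
rewrite exprD expr2.
move: (q%:R : algC) (q%:R ^+ r.+1) qn0 (hyper_coef _ _ _ _) (jacobi_coef _ _ _ _) h2 => qq y q0 H jc.
move: (X h e%:R) (X (k *+ d) d%:R) Xd0 (X (k *+ e) e%:R) Xe0 (X (k *+ d) a) Xa0 (X k b)
  => xh xd xd0 xe xe0 xa xa0 xb h2 HE.
have {}HE : y * (qq * H) = xd^-1 * (xh * xe) * jc.
  by apply: (mulfI q0); transitivity (y * (qq * qq) * H); [ring | rewrite HE; ring].
transitivity (y * (qq * H) * xh * (xb * xd / (xa * xe))); first by ring.
rewrite HE; transitivity (xh * xh * (xb * (xa^-1 * jc))); first by field; rewrite xa0 xe0 xd0.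
by rewrite h2 mul1r.
Qed.

Lemma curve_sum a b : a != 0 -> b != 0 ->
  Q%:R * \sum_(x | x != 0) X h (x ^+ d + a * x ^+ e + b) =
  q%:R ^+ r.+1 * X h e%:R * (q%:R * \sum_(k < Q) hyper_coef t r c k%:Z
     * X k%:Z (b * d%:R ^+ d / (a ^+ d * e%:R ^+ e))).
Proof.
move=> a0 b0.
rewrite (fourier_inversion t_char g_prim tg_prim
  (fun y => \sum_(x | x != 0) X h (x ^+ d + a * x ^+ e + y)) b0).
rewrite mulr_sumr mulr_sumr; apply: eq_bigr => k _.
rewrite (curve_fourier_coef t_char g_prim tg_prim QE) // -hyper_jacobi //.
by rewrite !mulrA.
Qed.

End Comparison.

(** * Translating the series and the point count into exponents of [T] *)

Lemma PoszMn n j : (n * j)%N%:Z = n%:Z *+ j.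
Proof. by rewrite PoszM -mulr_natr natz. Qed.

Lemma eq_jbin (F : finFieldType) (A A' B B' : F -> algC) :
  A =1 A' -> B =1 B' -> jbin A B = jbin A' B'.
Proof.
by move=> AA BB; rewrite /jbin BB; congr (_ * _); apply: eq_bigr => x _; rewrite AA BB.
Qed.

Theorem theorem1p3 (F : finFieldType) (p e : nat) (Hp : prime p) (Hq : #|F| = (p ^ e)%N)
  (d : nat) (Hd : (2 <= d)%N) (Hdeven : ~~ odd d)
  (Hqd : #|F| = 1 %[mod 2 * d * (d - 1)])
  (a b : F) (Ha : a != 0) (Hb : b != 0)
  (T : 'CF(UG F)) (HT : T \is a linear_char)
  (HTgen : forall xi : 'CF(UG F), xi \is a linear_char -> exists k : nat, xi = T ^+ k) :
  let q := #|F| in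
  let chi := T ^+ ((q - 1) %/ d) in
  let psi := T ^+ ((q - 1) %/ (2 * (d - 1))) in
  let beta := b * (d%:R) ^+ d / (a ^+ d * ((d - 1)%:R) ^+ (d - 1)) in
  let ABs := (@epsc F, @phiq F) ::
     [seq (mch (chi ^+ j), mch (psi ^+ (2 * j - 1))) | j <- iota 1 (d - 1) & j != d./2] in
  (#|[set xy : F * F | xy.2 ^+ 2 == xy.1 ^+ d + a * xy.1 ^+ (d - 1) + b]|)%:R
  = (q%:R : algC) + @phiq F b
    + (q%:R) ^+ (d./2) * @phiq F ((d - 1)%:R) * HGF (@phiq F) ABs beta.
Proof.
move=> q chi psi beta ABs.
have q1 : (1 < #|F|)%N := card_finField_gt1 F.
have [r dE] : exists r, d = (2 * r + 2)%N.
  by exists (d./2).-1; have := odd_double_half d; rewrite (negPf Hdeven); lia.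
have eE : (d - 1 = 2 * r + 1)%N by lia.
have hE : d./2 = r.+1 by rewrite dE; lia.
have [c QE] : exists c, (#|F| - 1 = 2 * (2 * r + 2) * (2 * r + 1) * c)%N.
  have /dvdnP[c cE] : (2 * d * (d - 1) %| #|F| - 1)%N by rewrite -(eqn_mod_dvd _ (ltnW q1)); apply/eqP.
  by exists c; rewrite cE mulnC eE dE.
have chiE : ((q - 1) %/ d = 2 * (2 * r + 1) * c)%N.
  rewrite /q QE dE (_ : _ * c = 2 * (2 * r + 1) * c * (2 * r + 2))%N; last by clear; lia.
  by rewrite mulnK // addn2.
have psiE : ((q - 1) %/ (2 * (d - 1)) = (2 * r + 2) * c)%N.
  rewrite /q QE eE (_ : _ * c = (2 * r + 2) * c * (2 * (2 * r + 1)))%N; last by clear; lia.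
  by rewrite mulnK // addn1.
have [theta theta_char] := exists_addchar F.
have [g g_prim] := finField_prim_root F.
have t_char := mch_mulchar HT; have tg_prim := mch_gen_prim HT HTgen g_prim.
have F2 : 2%:R != 0 :> F by apply: natr_dvd_neq0; rewrite QE -!mulnA dvdn_mulr.
have phiE := phiq_cpow t_char g_prim tg_prim (half_orderD QE).
(* Over each [x] the number of [y] is 1 plus the quadratic character of the right-hand side. *)
have countE : (#|[set xy : F * F | xy.2 ^+ 2 == xy.1 ^+ d + a * xy.1 ^+ (d - 1) + b]|)%:R
    = \sum_x (1 + phiq (x ^+ d + a * x ^+ (d - 1) + b)) :> algC.
  rewrite -sum1_card natr_sum big_mkcond /=.
  rewrite (eq_bigr (fun xy : F * F => (xy.2 ^+ 2 == xy.1 ^+ d + a * xy.1 ^+ (d - 1) + b)%:R)); last first.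
    by move=> xy _; rewrite inE; case: ifP.
  rewrite -(pair_big xpredT xpredT (fun x y : F => (y ^+ 2 == x ^+ d + a * x ^+ (d - 1) + b)%:R)) /=.
  by apply: eq_bigr => x _; rewrite sum_sqrt_phiq.
have Qn0 : (#|F| - 1)%:R != 0 :> algC by rewrite pnatr_eq0 -lt0n (prim_order_gt0 g_prim).
have betaE : beta = b * (2 * r + 2)%:R ^+ (2 * r + 2) / (a ^+ (2 * r + 2) * (2 * r + 1)%:R ^+ (2 * r + 1)).
  by rewrite /beta eE dE.
have HGFE : HGF (@phiq F) ABs beta = #|F|%:R / (#|F| - 1)%:R *
    \sum_(k < #|F| - 1) hyper_coef (mch T) r c k%:Z * cpow (mch T) k%:Z beta.
  rewrite /HGF natrB ?(ltnW q1) //; congr (_ * _).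
  pose E A := jbin (cmul (@phiq F) A) A *
    \prod_(AB <- ABs) jbin (cmul AB.1 A) (cmul AB.2 A) * A beta.
  have cmulE A B B' : B =1 B' -> cmul A B =1 cmul A B' by move=> BB x; rewrite /cmul BB.
  rewrite (sum_Iirr_mch HT HTgen (E := E) g_prim) /E {E}; last first.
    move=> A B AB; congr (_ * _ * _); last exact: AB.
      by apply: eq_jbin => //; apply: cmulE.
    by apply: eq_bigr => XY _; apply: eq_jbin; apply: cmulE.
  apply: eq_bigr => k _; congr (_ * _); rewrite /hyper_coef /ABs big_cons big_map big_filter.
  have cmulX A l : A =1 cpow (mch T) l -> cmul A (cpow (mch T) k%:Z) =1 cpow (mch T) (l + k%:Z).
    by move=> Al x; rewrite /cmul Al (cpowD t_char).
  congr (_ * _); first by apply: jbin_cpow => //; apply: cmulX.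
  congr (_ * _).
    apply: jbin_cpow; last exact: cmulX.
    move=> x; rewrite /cmul /= /epsc; have [->|x0] := eqVneq x 0; last by rewrite mul1r.
    by rewrite cpow0 mulr0.
  rewrite eE hE; apply: eq_bigr => j _; apply: jbin_cpow; apply: cmulX => x.
    rewrite /= /chi -exprM mch_exp; congr (cpow _ _ _).
    by rewrite chiE PoszMn.
  rewrite /= /psi -exprM mch_exp; congr (cpow _ _ _).
  by rewrite psiE PoszMn.
rewrite countE big_split /= sumr_const -addrA; congr (_ + _).
have d0 : (0 < d)%N := ltnW Hd.
have e0 : (0 < d - 1)%N by rewrite subn_gt0.
(* The abscissa [x = 0] yields [phi (b)]; only nonzero [x] enter the comparison, which is multiplied
   by [q - 1] to match [curve_sum]. *)
rewrite (bigD1 0) //= !expr0n !gtn_eqF // mulr0 !add0r.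
congr (_ + _); apply: (mulfI Qn0).
have -> : \sum_(x | x != 0) phiq (x ^+ d + a * x ^+ (d - 1) + b) =
    \sum_(x | x != 0) cpow (mch T) (half_order r c)%:Z (x ^+ (2 * r + 2) + a * x ^+ (2 * r + 1) + b).
  by rewrite -eE -dE; apply: eq_bigr => x _; rewrite phiE.
rewrite (curve_sum theta_char t_char g_prim tg_prim QE Ha Hb) HGFE betaE hE eE phiE /q.
move: (bigop _ _ _) (_ ^+ r.+1) (cpow _ _ _) => S y x.
by field.
Qed.
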